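(* Let $D\subset\mathbb{C}^n$ be a domain and let $\varphi:D\to[-\infty,+\infty)$ be an upper semicontinuous function that is not identically $-\infty$. Let $p>0$ be a fixed constant. Suppose there are constants $C_m>0$ ($m=1,2,3,\dots$), independent of $z_0$ below, with $\lim_{m\to\infty}\frac1m\log C_m=0$, such that for every $z_0\in D$ with $\varphi(z_0)>-\infty$ and every integer $m>0$ there is a holomorphic function $f\in\mathcal{O}(D)$ with $f(z_0)=1$ and $$\int_D|f|^{p}e^{-m\varphi}\le C_m e^{-m\varphi(z_0)}.$$ Then $\varphi$ is plurisubharmonic on $D$.
   Context: Integrals are with respect to Lebesgue measure on $\mathbb{C}^n$, and $e^{-m\varphi}=+\infty$ where $\varphi=-\infty$. $\mathcal{O}(D)$ denotes the holomorphic functions on $D$. *)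

(* Defs.v *)
From HB Require Import structures.
From mathcomp Require Import all_boot all_order all_algebra complex.
From mathcomp Require Import all_classical all_reals all_analysis.

Set Implicit Arguments.
Unset Strict Implicit.
Unset Printing Implicit Defensive.

Import Order.TTheory GRing.Theory Num.Theory.
Import numFieldNormedType.Exports.

Local Open Scope classical_set_scope.
Local Open Scope ring_scope.

(* The topology and norm of [R[i]] as a numFieldType, made available on the
   concrete type; the topology of ['rV[R[i]]_n] (sup norm) follows from it. *)
HB.instance Definition _ (R : realType) :=
  PseudoPointedMetric.copy R[i] R[i]^o.
HB.instance Definition _ (R : realType) := GRing.ComAlgebra.copy R[i] R[i]^o.
HB.instance Definition _ (R : realType) := Vector.copy R[i] R[i]^o.
HB.instance Definition _ (R : realType) := NormedModule.copy R[i] R[i]^o.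
HB.instance Definition _ (R : realType) := Num.ClosedField.on R[i].

(* [m1 \x m2] under a name of its own: for sigma-finite factors, canonical
   structure inference does not find the sigma-finiteness of [m1 \x m2]. *)
Section binary_product.
Context d1 d2 (T1 : measurableType d1) (T2 : measurableType d2)
  (R : realType).
Variables (m1 : {sigma_finite_measure set T1 -> \bar R})
  (m2 : {sigma_finite_measure set T2 -> \bar R}).

Definition prod_measure : set (T1 * T2) -> \bar R := (m1 \x m2)%E.

HB.instance Definition _ := Measure.copy prod_measure (m1 \x m2)%E.

Let prod_measure_sigma_finite : sigma_finite setT prod_measure.
Proof.
have /sigma_finiteP[F [TF ndF Foo]] := sigma_finiteT m1.
have /sigma_finiteP[G [TG ndG Goo]] := sigma_finiteT m2.
exists (fun k => F k `*` G k) => [|k].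
  rewrite -setXTT TF TG predeqE => -[x y]; split.
    move=> [/= [j _ Fjx] [k _ Gky]]; exists (maxn j k) => //; split.
    - by move: x Fjx; exact/subsetPset/ndF/leq_maxl.
    - by move: y Gky; exact/subsetPset/ndG/leq_maxr.
  by move=> [k _ []/= ? ?]; split; exists k.
have [? ?] := Foo k; have [? ?] := Goo k.
split; first exact: measurableX.
by rewrite /prod_measure product_measure1E// lte_mul_pinfty// ge0_fin_numE.
Qed.

HB.instance Definition _ := Measure_isSigmaFinite.Build _ _ _ prod_measure
  prod_measure_sigma_finite.

End binary_product.

(* The library has no product measure on tuples: it is built here by
   iterating the binary product. *)
Section cons_measure.
Context d (T : measurableType d) (R : realType) (n : nat).
Variables (mu : {sigma_finite_measure set T -> \bar R})
  (nu : {sigma_finite_measure set (n.-tuple T) -> \bar R}).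

Definition cons_pair (p : T * n.-tuple T) : n.+1.-tuple T :=
  [tuple of p.1 :: p.2].

Lemma measurable_cons_pair : measurable_fun [set: T * n.-tuple T] cons_pair.
Proof. exact: measurable_cons. Qed.

Definition cons_measure : set (n.+1.-tuple T) -> \bar R :=
  pushforward (prod_measure mu nu) cons_pair.

Let cons_measure0 : cons_measure set0 = 0%E.
Proof. by rewrite /cons_measure /pushforward preimage_set0 measure0. Qed.

Let cons_measure_ge0 A : (0 <= cons_measure A)%E.
Proof. by rewrite /cons_measure /pushforward measure_ge0. Qed.

Let cons_measure_sigma_additive : semi_sigma_additive cons_measure.
Proof.
move=> F mF tF mUF; rewrite /cons_measure /pushforward preimage_bigcup.
apply: measure_semi_sigma_additive.
- by move=> k; rewrite -[X in measurable X]setTI; exact: measurable_cons_pair.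
- apply/trivIsetP => /= i j _ _ ij; rewrite -preimage_setI.
  by move/trivIsetP : tF => /(_ _ _ _ _ ij) ->//; rewrite preimage_set0.
- rewrite -preimage_bigcup -[X in measurable X]setTI.
  exact: measurable_cons_pair.
Qed.

HB.instance Definition _ := isMeasure.Build _ _ _ cons_measure
  cons_measure0 cons_measure_ge0 cons_measure_sigma_additive.

Let cons_measure_sigma_finite : sigma_finite setT cons_measure.
Proof.
have [F FT Foo] := sigma_finiteT (prod_measure mu nu).
pose g (t : n.+1.-tuple T) := (thead t, [tuple of behead t]).
have mg : measurable_fun setT g.
  apply/measurable_fun_pairP; split => /=.
  - exact: measurable_tnth.
  - exact: measurable_behead.
have gK p : g (cons_pair p) = p.
  case: p => x t; rewrite /g; congr pair; exact/val_inj.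
exists (fun i => g @^-1` F i) => [|i].
  by rewrite -preimage_bigcup -FT preimage_setT.
have [mFi Fioo] := Foo i; split.
  by rewrite -[X in measurable X]setTI; exact: mg.
rewrite /cons_measure /pushforward -comp_preimage.
by rewrite (_ : g \o cons_pair = id)//; apply/funext.
Qed.

HB.instance Definition _ := Measure_isSigmaFinite.Build _ _ _ cons_measure
  cons_measure_sigma_finite.

End cons_measure.

Fixpoint tuple_measure d (T : measurableType d) (R : realType)
    (mu : {sigma_finite_measure set T -> \bar R}) (n : nat) :
    {sigma_finite_measure set (n.-tuple T) -> \bar R} :=
  if n is m.+1 then cons_measure mu (tuple_measure mu m)
  else \d_([tuple] : 0.-tuple T).

Lemma tuple_measure_box d (T : measurableType d) (R : realType)
    (mu : {sigma_finite_measure set T -> \bar R}) (n : nat)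
    (A : 'I_n -> set T) : (forall j, measurable (A j)) ->
  tuple_measure mu n [set t | forall j, A j (tnth t j)] =
  (\prod_(j < n) mu (A j))%E.
Proof.
elim: n A => [|n IH] A mA.
  by rewrite big_ord0 /= diracE mem_set// => -[].
rewrite big_ord_recl /= /cons_measure /pushforward.
rewrite (_ : _ @^-1` _ = A ord0 `*`
    [set t : n.-tuple T | forall j : 'I_n, A (lift ord0 j) (tnth t j)]);
    last first.
  apply/seteqP; split => -[x t] /=.
    move=> H; split=> [|j]; first exact: (H ord0).
    by have := H (lift ord0 j); rewrite tnthS.
  move=> [Ax At] j; have [->//|/eqP] := eqVneq j ord0.
  by case: (unliftP ord0 j) => [k -> _|->//]; rewrite tnthS.
rewrite /prod_measure product_measure1E//.
  by congr (_ * _)%E; exact: (IH (fun j => A (lift ord0 j))).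
rewrite (_ : [set t | _] =
   \bigcap_(j in [set: 'I_n]) (fun t => tnth t j) @^-1` A (lift ord0 j)).
  apply: fin_bigcap_measurable => // j _.
  by rewrite -[X in measurable X]setTI; exact: measurable_tnth.
by apply/seteqP; split=> [t H j _|t H j]; exact: H.
Qed.

Section several_complex_variables.
Context {R : realType}.
Local Notation plane := (measurableTypeR R * measurableTypeR R)%type.

(* (x_j, y_j)_j |-> (x_j + i y_j)_j identifies R^(2n) with C^n. *)
Definition complexify n (t : n.-tuple plane) : 'rV[R[i]]_n :=
  \row_j ((tnth t j).1 +i* (tnth t j).2)%C.

Definition lebesgue_tuple n :
    {sigma_finite_measure set (n.-tuple plane) -> \bar R} :=
  tuple_measure (prod_measure (@lebesgue_measure R) (@lebesgue_measure R)) n.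

Definition integral_Cn n (D : set 'rV[R[i]]_n) (F : 'rV[R[i]]_n -> \bar R)
    : \bar R :=
  (\int[@lebesgue_tuple n]_(t in @complexify n @^-1` D) F (complexify t))%E.

Definition domain n (D : set 'rV[R[i]]_n) : Prop :=
  [/\ D !=set0, open D & connected D].

(* [f] is a total function, but for an open [D] only its values on [D]
   matter. *)
Definition holomorphic n (D : set 'rV[R[i]]_n) (f : 'rV[R[i]]_n -> R[i])
    : Prop :=
  forall z, D z -> differentiable f z.

Definition usc_on (X : topologicalType) (D : set X) (u : X -> \bar R) : Prop :=
  forall x, D x -> forall a : R, (u x < a%:E)%E ->
    \forall y \near within D (nbhs x), (u y < a%:E)%E.

Definition cmod (z : R[i]) : R := ComplexField.Normc.normc z.

Definition circle_point (c : R[i]) (r t : R) : R[i] :=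
  c + r%:C%C * (cos t +i* sin t)%C.

Definition circle_mean (u : R[i] -> \bar R) (c : R[i]) (r : R) : \bar R :=
  ((2 * pi)^-1%:E *
   \int[lebesgue_measure]_(t in `[0%R, (2 * pi)%R]) u (circle_point c r t))%E.

(* As usual in this context, [u = -oo] is allowed. *)
Definition subharmonic (U : set R[i]) (u : R[i] -> \bar R) : Prop :=
  [/\ forall z, U z -> (u z < +oo)%E,
      usc_on U u &
      forall (c : R[i]) (r : R), 0 < r ->
        [set z | cmod (z - c) <= r] `<=` U -> (u c <= circle_mean u c r)%E].

Definition plurisubharmonic n (D : set 'rV[R[i]]_n)
    (phi : 'rV[R[i]]_n -> \bar R) : Prop :=
  [/\ forall z, D z -> (phi z < +oo)%E,
      usc_on D phi &
      forall a b : 'rV[R[i]]_n,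
        subharmonic [set tau : R[i] | D (a + tau *: b)]
                    (fun tau => phi (a + tau *: b))].

End several_complex_variables.

(* Main.v *)
From HB Require Import structures.
Require Import Defs.
From mathcomp Require Import all_boot all_order all_algebra complex.
From mathcomp Require Import all_classical all_reals all_analysis.
From mathcomp Require Import measurable_realfun ring lra.

(** Why the theorem is true.  Fix a closed disc in a complex line inside [D],
    with centre [z0] and [phi z0 = v] finite, and cut its boundary circle into
    [N] equal arcs.  Let [g k] be an upper bound of [phi] on a neighbourhood of
    the [k]-th arc.  The heart of the matter is
      [N * v <= \sum_(k < N) g k]      (lemma [arc_average_ge]);
    when [N] grows and the neighbourhoods shrink, upper semicontinuity and
    Fatou's lemma turn the averages of the [g k] into the circle mean of [phi]
    (lemma [mean_ge_of_arc_averages]), which is the sub-mean value inequality.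

    To bound [v], take for each [m] the given function [f] with [f z0 = 1].
    The power [|f| ^ p] satisfies a sub-mean value inequality on small
    polydiscs, so at a point [w] of the [k]-th arc the integral bound yields
      [|f w| ^ p <= K * C_m * exp (m * (g k - v))]    (lemma [point_estimate]),
    with [K] depending on the size of the polydiscs but not on [m].  On the
    other hand the holomorphic function [\prod_k f (w_k z)], where the [w_k]
    are the [N]-th roots of unity, equals [1] at the centre, so by the maximum
    principle it is at least [1] in modulus at some point of the circle; the
    rotates of that point lie one in each arc (lemma [max_modulus_prod]).
    Multiplying the [N] estimates gives
      [0 <= N * ln (K * C_m) + m * (\sum_k g k - N * v)],
    and division by [m] removes the constants because [ln C_m / m] tends to [0].
    Taking products over roots of unity replaces Jensen's formula: neither
    [log |f|] nor the zeros of [f] ever appear.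

    The same trick gives the sub-mean value inequality for [|f| ^ p], also when
    [p < 1]: the arithmetic-geometric mean inequality turns the product over
    rotates into an average of [|f| ^ p] over rotates, and averaging over a disc
    with the rotation invariance of Lebesgue measure gives the inequality in one
    variable (lemma [disc_submean]); Tonelli's theorem gives it on polydiscs
    (lemma [polydisc_submean]).

    Everything thus rests on the maximum principle for functions that are
    complex differentiable at each point.  It follows from the mean value
    property, which is Goursat's theorem (lemma [goursat]) in the strip of the
    logarithmic variable [s + i t], where circles around [0] are vertical
    segments. *)

Set Implicit Arguments.
Unset Strict Implicit.
Unset Printing Implicit Defensive.

Import Order.TTheory GRing.Theory Num.Theory.
Import numFieldNormedType.Exports.

Local Open Scope classical_set_scope.
Local Open Scope ring_scope.

(** * Goursat's theorem for closed real 1-forms *)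

Section closed_forms.
Context {R : realType}.
Implicit Types (a b c e x y : R) (f g : R -> R).
Local Notation mu := (@lebesgue_measure R).
Local Notation integrable_on a b f := (mu.-integrable `[a, b] (EFin \o f)).

Let J a b f : R := \int[mu]_(x in `[a, b]) f x.

Lemma integrable_on_sub a b x y f : a <= x -> y <= b ->
  integrable_on a b f -> integrable_on x y f.
Proof.
move=> ax yb; apply: integrableS => //; apply: subset_itv; rewrite bnd_simp//.
Qed.

Lemma integrable_onB a b f g : integrable_on a b f -> integrable_on a b g ->
  integrable_on a b (fun x => f x - g x).
Proof.
move=> intf intg.
exact: (@integrableB _ _ _ mu _ (measurable_itv _) _ _ intf intg).
Qed.

Lemma Rintegral_itv_split a b c f : a <= c -> c <= b -> integrable_on a b f ->
  J a b f = J a c f + J c b f.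
Proof.
move=> ac cb intf; rewrite /J; have := @Rintegral_itvB R f (BLeft a) (BRight b) c intf.
rewrite !bnd_simp => /(_ ac cb) /eqP; rewrite subr_eq => /eqP ->.
rewrite addrC; congr (_ + _); rewrite Rintegral_itv_obnd_cbnd//.
apply: integrableS intf => //; apply: subset_itv; rewrite bnd_simp//.
Qed.

Let integrable_on_cst a b (r : R) : integrable_on a b (fun=> r).
Proof.
apply: continuous_compact_integrable; first exact: segment_compact.
by apply: continuous_subspaceT => x; exact: cvg_cst.
Qed.

Let Rintegral_itv_cst a b (r : R) : a <= b -> J a b (fun=> r) = r * (b - a).
Proof.
move=> ab; rewrite /J Rintegral_cst//= lebesgue_measure_itv/= lte_fin.
by case: ltrP => // ba; rewrite (_ : b = a) ?subrr//; apply/le_anti/andP.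
Qed.

Lemma Rintegral_itv_le a b f (k : R) : a <= b -> integrable_on a b f ->
  (forall x, a <= x <= b -> f x <= k) -> J a b f <= k * (b - a).
Proof.
move=> ab intf H; rewrite -Rintegral_itv_cst//.
by apply: le_Rintegral => // x /=; rewrite in_itv/= => /H.
Qed.

Lemma Rintegral_itv_ge a b f (k : R) : a <= b -> integrable_on a b f ->
  (forall x, a <= x <= b -> k <= f x) -> k * (b - a) <= J a b f.
Proof.
move=> ab intf H; rewrite -Rintegral_itv_cst//.
by apply: le_Rintegral => // x /=; rewrite in_itv/= => /H.
Qed.

Lemma Rintegral_itv_near a b f (k e : R) : a <= b -> integrable_on a b f ->
  (forall x, a <= x <= b -> `|f x - k| <= e) ->
  `|J a b f - k * (b - a)| <= e * (b - a).
Proof.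
move=> ab intf H; rewrite ler_norml lerBrDr lerBlDr -mulNr -!mulrDl.
rewrite Rintegral_itv_ge ?Rintegral_itv_le// => x /H;
  by rewrite ler_norml => /andP[]; lra.
Qed.

Lemma nested_segments (u w : R^nat) :
  (forall k, u k <= u k.+1) -> (forall k, u k.+1 + w k.+1 <= u k + w k) ->
  (forall k, 0 <= w k) -> exists x, forall k, u k <= x <= u k + w k.
Proof.
move=> uS uwS w0; have uD k j : u k <= u (k + j)%N.
  by elim: j => [|j IH]; rewrite ?addn0// addnS (le_trans IH).
have uwD k j : u (k + j)%N + w (k + j)%N <= u k + w k.
  by elim: j => [|j IH]; rewrite ?addn0// addnS (le_trans _ IH).
have uw k j : u j <= u k + w k.
  have [jk|kj] := leqP j k.
    by rewrite -(subnKC jk) (le_trans (uD j (k - j)%N))// lerDl.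
  by rewrite -(subnKC (ltnW kj)) (le_trans _ (uwD k (j - k)%N))// lerDl.
have ubr k : ubound (range u) (u k + w k) by move=> _ [j _ <-].
exists (sup (range u)) => k; apply/andP; split.
  apply: ub_le_sup; last by exists k.
  by exists (u 0 + w 0).
by apply: ge_sup; [exists (u 0), 0 | exact: ubr].
Qed.

Section goursat.
Variables (P Q : R -> R -> R) (a1 a2 b1 b2 : R).
Hypotheses (a12 : (a1 : R) < a2) (b12 : (b1 : R) < b2).
Hypothesis intP : forall y, b1 <= y <= b2 -> integrable_on a1 a2 (P^~ y).
Hypothesis intQ : forall x, a1 <= x <= a2 -> integrable_on b1 b2 (Q x).
Hypothesis closedPQ : forall x y, a1 <= x <= a2 -> b1 <= y <= b2 ->
  exists A Px Qy : R, forall e : R, 0 < e -> exists2 d : R, 0 < d & forall x' y',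
    a1 <= x' <= a2 -> b1 <= y' <= b2 -> `|x' - x| < d -> `|y' - y| < d ->
    `|P x' y' - P x y - (Px * (x' - x) + A * (y' - y))|
       <= e * (`|x' - x| + `|y' - y|) /\
    `|Q x' y' - Q x y - (A * (x' - x) + Qy * (y' - y))|
       <= e * (`|x' - x| + `|y' - y|).

(** The circulation of [P dx + Q dy] around the rectangle
    [[x1, x2] x [y1, y2]]. *)
Let Phi x1 x2 y1 y2 : R :=
  J x1 x2 (fun x => P x y1 - P x y2) + J y1 y2 (fun y => Q x2 y - Q x1 y).

Let inrect x1 x2 y1 y2 :=
  [/\ a1 <= x1, x1 <= x2, x2 <= a2 & [/\ b1 <= y1, y1 <= y2 & y2 <= b2]].

Let intP' x1 x2 y1 y2 y : inrect x1 x2 y1 y2 -> y1 <= y <= y2 ->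
  integrable_on x1 x2 (P^~ y).
Proof.
move=> [? ? ? [? ? ?]] ?; apply: (@integrable_on_sub a1 a2) => //.
by apply: intP; lra.
Qed.

Let intQ' x1 x2 y1 y2 x : inrect x1 x2 y1 y2 -> x1 <= x <= x2 ->
  integrable_on y1 y2 (Q x).
Proof.
move=> [? ? ? [? ? ?]] ?; apply: (@integrable_on_sub b1 b2) => //.
by apply: intQ; lra.
Qed.

Let intBP x1 x2 y1 y2 y y' : inrect x1 x2 y1 y2 -> y1 <= y <= y2 ->
  y1 <= y' <= y2 -> integrable_on x1 x2 (fun x => P x y - P x y').
Proof.
move=> r h h'.
exact: integrable_onB (intP' r h) (intP' r h').
Qed.

Let intBQ x1 x2 y1 y2 x x' : inrect x1 x2 y1 y2 -> x1 <= x <= x2 ->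
  x1 <= x' <= x2 -> integrable_on y1 y2 (fun y => Q x y - Q x' y).
Proof.
move=> r h h'.
exact: integrable_onB (intQ' r h) (intQ' r h').
Qed.

Let Phi_splitx x1 x x2 y1 y2 : inrect x1 x2 y1 y2 -> x1 <= x <= x2 ->
  Phi x1 x2 y1 y2 = Phi x1 x y1 y2 + Phi x x2 y1 y2.
Proof.
move=> r hx; have [/andP[? ?] [? ? ? [? ? ?]]] := (hx, r).
have [? ?] : y1 <= y1 <= y2 /\ y1 <= y2 <= y2 by split; lra.
have [? ?] : x1 <= x1 <= x2 /\ x1 <= x2 <= x2 by split; lra.
rewrite /Phi (@Rintegral_itv_split _ _ x)//; last exact: intBP r _ _.
rewrite (_ : J y1 y2 (fun y => Q x2 y - Q x1 y) =
    J y1 y2 (fun y => Q x y - Q x1 y) + J y1 y2 (fun y => Q x2 y - Q x y)).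
  ring.
rewrite -RintegralD//; [|exact: intBQ r _ _|exact: intBQ r _ _].
by apply: eq_Rintegral => y _; ring.
Qed.

Let Phi_splity x1 x2 y1 y y2 : inrect x1 x2 y1 y2 -> y1 <= y <= y2 ->
  Phi x1 x2 y1 y2 = Phi x1 x2 y1 y + Phi x1 x2 y y2.
Proof.
move=> r hy; have [/andP[? ?] [? ? ? [? ? ?]]] := (hy, r).
have [? ?] : y1 <= y1 <= y2 /\ y1 <= y2 <= y2 by split; lra.
have [? ?] : x1 <= x1 <= x2 /\ x1 <= x2 <= x2 by split; lra.
rewrite /Phi [X in _ + X](@Rintegral_itv_split _ _ y)//; last exact: intBQ r _ _.
rewrite (_ : J x1 x2 (fun x => P x y1 - P x y2) =
    J x1 x2 (fun x => P x y1 - P x y) + J x1 x2 (fun x => P x y - P x y2)).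
  ring.
rewrite -RintegralD//; [|exact: intBP r _ _|exact: intBP r _ _].
by apply: eq_Rintegral => x _; ring.
Qed.

(** The cross coefficient [A] enters the horizontal sides with weight
    [- A * h * w] and the vertical ones with weight [A * w * h]: the first order
    terms cancel, and only the error terms of the expansions remain. *)
Let Phi_bound (x y w h x0 y0 A Px Qy e d : R) : 0 <= w -> 0 <= h -> 0 < e ->
  inrect x (x + w) y (y + h) -> w < d -> h < d ->
  x <= x0 <= x + w -> y <= y0 <= y + h ->
  (forall x' y',
    a1 <= x' <= a2 -> b1 <= y' <= b2 -> `|x' - x0| < d -> `|y' - y0| < d ->
    `|P x' y' - P x0 y0 - (Px * (x' - x0) + A * (y' - y0))|
       <= e * (`|x' - x0| + `|y' - y0|) /\
    `|Q x' y' - Q x0 y0 - (A * (x' - x0) + Qy * (y' - y0))|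
       <= e * (`|x' - x0| + `|y' - y0|)) ->
  `|Phi x (x + w) y (y + h)| <= 2 * e * (w + h) ^+ 2.
Proof.
move=> w0 h0 e0 r wd hd hx hy H; have [? ? ? [? ? ?]] := r.
have H' x' y' : x <= x' <= x + w -> y <= y' <= y + h ->
    `|P x' y' - P x0 y0 - (Px * (x' - x0) + A * (y' - y0))| <= e * (w + h) /\
    `|Q x' y' - Q x0 y0 - (A * (x' - x0) + Qy * (y' - y0))| <= e * (w + h).
  move=> hx' hy'.
  have Hx : `|x' - x0| <= w by rewrite ler_norml; lra.
  have Hy : `|y' - y0| <= h by rewrite ler_norml; lra.
  have le_wh : e * (`|x' - x0| + `|y' - y0|) <= e * (w + h).
    by rewrite ler_pM2l// lerD.
  have [||||U V] := H x' y'; [lra|lra|exact: le_lt_trans Hx wd|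
    exact: le_lt_trans Hy hd|].
  by split; apply: le_trans le_wh.
have [? ?] : y <= y <= y + h /\ y <= y + h <= y + h by split; lra.
have [? ?] : x <= x <= x + w /\ x <= x + w <= x + w by split; lra.
have I1 : `|J x (x + w) (fun x => P x y - P x (y + h)) - - A * h * (x + w - x)|
    <= 2 * e * (w + h) * (x + w - x).
  apply: Rintegral_itv_near => [||x' hx']; [lra|exact: intBP r _ _|].
  have [//|//|+ _] := H' x' y; have [//|//|+ _] := H' x' (y + h).
  by rewrite !ler_norml => /andP[? ?] /andP[? ?]; lra.
have I2 : `|J y (y + h) (fun y => Q (x + w) y - Q x y) - A * w * (y + h - y)|
    <= 2 * e * (w + h) * (y + h - y).
  apply: Rintegral_itv_near => [||y' hy']; [lra|exact: intBQ r _ _|].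
  have [//|//|_] := H' x y'; have [//|//|_] := H' (x + w) y'.
  by rewrite !ler_norml => /andP[? ?] /andP[? ?]; lra.
move: I1 I2; rewrite /Phi !ler_norml => /andP[? ?] /andP[? ?]; lra.
Qed.

(** Closedness is the equality of the cross coefficients [A] in the first order
    expansions of [P] and [Q] at each point.  The circulation is additive, so if
    its ratio to the area exceeds [ep] for some rectangle, it does so for one of
    its quarters.  Iterating, the quarters shrink to a point, where [Phi_bound]
    makes this ratio tend to [0]. *)
Lemma goursat : J a1 a2 (P^~ b1) + J b1 b2 (Q a2) =
  J a1 a2 (P^~ b2) + J b1 b2 (Q a1).
Proof.
have r0 : inrect a1 a2 b1 b2 by do ?split => //; exact: ltW.
have [? ?] : a1 <= a1 <= a2 /\ a1 <= a2 <= a2 by rewrite !lexx !ltW.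
have [? ?] : b1 <= b1 <= b2 /\ b1 <= b2 <= b2 by rewrite !lexx !ltW.
suff : Phi a1 a2 b1 b2 = 0.
  rewrite /Phi /J !RintegralB//; try exact: intQ; try exact: intP.
  rewrite -!/(J _ _ _); lra.
apply/eqP/negPn/negP => Phi0.
have stay (x d : R) : 0 <= d -> x <= x /\ x + d <= x + (d + d).
  by move=> d0; rewrite lexx lerD2l lerDl.
have move_on (x d : R) : 0 <= d -> x <= x + d /\ x + d + d <= x + (d + d).
  by move=> d0; rewrite lerDl addrA.
pose W := a2 - a1; pose H := b2 - b1.
have W0 : 0 < W by rewrite subr_gt0.
have H0 : 0 < H by rewrite subr_gt0.
have WH0 : 0 < W * H by rewrite mulr_gt0.
pose ep := `|Phi a1 a2 b1 b2| / (2 * (W * H)).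
have ep0 : 0 < ep by rewrite divr_gt0 ?normr_gt0 ?mulr_gt0.
pose bad x y w h := ep * (w * h) < `|Phi x (x + w) y (y + h)|.
have bad_halves x y w h : 0 <= w -> 0 <= h ->
    inrect x (x + (w + w)) y (y + (h + h)) -> bad x y (w + w) (h + h) ->
    [\/ bad x y w h, bad (x + w) y w h, bad x (y + h) w h |
        bad (x + w) (y + h) w h].
  move=> w0 h0 r; rewrite /bad.
  have [? ? ? [? ? ?]] := r.
  have E : Phi x (x + (w + w)) y (y + (h + h)) =
      Phi x (x + w) y (y + h) + Phi x (x + w) (y + h) (y + h + h) +
      (Phi (x + w) (x + w + w) y (y + h) +
       Phi (x + w) (x + w + w) (y + h) (y + h + h)).
    rewrite (addrA x) (addrA y) in r *; rewrite (@Phi_splitx x (x + w))//; last lra.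
    congr (_ + _); apply: Phi_splity; try lra.
      by split; [lra|lra|lra|split; lra].
    by split; [lra|lra|lra|split; lra].
  rewrite E => bd.
  have [|n1] := ltrP (ep * (w * h)) `|Phi x (x + w) y (y + h)|.
    by constructor 1.
  have [|n2] := ltrP (ep * (w * h)) `|Phi (x + w) (x + w + w) y (y + h)|.
    by constructor 2.
  have [|n3] := ltrP (ep * (w * h)) `|Phi x (x + w) (y + h) (y + h + h)|.
    by constructor 3.
  have [|n4] := ltrP (ep * (w * h))
      `|Phi (x + w) (x + w + w) (y + h) (y + h + h)|; first by constructor 4.
  exfalso; move: bd; apply/negP; rewrite -leNgt.
  apply: le_trans (ler_normD _ _) _.
  apply: le_trans (lerD (ler_normD _ _) (ler_normD _ _)) _.
  lra.
pose wk k := W / 2 ^+ k; pose hk k := H / 2 ^+ k.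
have wkS k : wk k = wk k.+1 + wk k.+1.
  by rewrite /wk exprS; field; rewrite expf_neq0.
have hkS k : hk k = hk k.+1 + hk k.+1.
  by rewrite /hk exprS; field; rewrite expf_neq0.
have wk0 k : 0 < wk k by rewrite divr_gt0// exprn_gt0.
have hk0 k : 0 < hk k by rewrite divr_gt0// exprn_gt0.
pose step k (q : R * R) : R * R :=
  let w := wk k.+1 in let h := hk k.+1 in
  if `[< bad q.1 q.2 w h >] then q else
  if `[< bad (q.1 + w) q.2 w h >] then (q.1 + w, q.2) else
  if `[< bad q.1 (q.2 + h) w h >] then (q.1, q.2 + h) else
  (q.1 + w, q.2 + h).
pose fix q k := if k is k'.+1 then step k' (q k') else (a1, b1).
have stepP k (p : R * R) : bad p.1 p.2 (wk k) (hk k) ->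
    inrect p.1 (p.1 + wk k) p.2 (p.2 + hk k) ->
    let p' := step k p in
    [/\ bad p'.1 p'.2 (wk k.+1) (hk k.+1),
    (p.1 <= p'.1 /\ p'.1 + wk k.+1 <= p.1 + wk k) &
    (p.2 <= p'.2 /\ p'.2 + hk k.+1 <= p.2 + hk k)].
  rewrite (wkS k) (hkS k) => bd r /=.
  have w0 := ltW (wk0 k.+1); have h0 := ltW (hk0 k.+1).
  have := bad_halves _ _ _ _ w0 h0 r bd; rewrite /step.
  have sw x := stay x _ w0; have sh x := stay x _ h0.
  have mw x := move_on x _ w0; have mh x := move_on x _ h0.
  case: asboolP => [b _|nb1].
    by split; [exact: b|exact: sw|exact: sh].
  case: asboolP => [b _|nb2].
    by split; [exact: b|exact: mw|exact: sh].
  case: asboolP => [b _|nb3].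
    by split; [exact: b|exact: sw|exact: mh].
  case=> [b|b|b|b]; [case: (nb1 b)|case: (nb2 b)|case: (nb3 b)|].
  by split; [exact: b|exact: mw|exact: mh].
have qP k : bad (q k).1 (q k).2 (wk k) (hk k) /\
    inrect (q k).1 ((q k).1 + wk k) (q k).2 ((q k).2 + hk k).
  elim: k => [|k [IH1 IH2]].
    have E1 : a1 + wk 0 = a2 by rewrite /wk expr0 divr1 /W; ring.
    have E2 : b1 + hk 0 = b2 by rewrite /hk expr0 divr1 /H; ring.
    rewrite /= E1 E2; split; last by [].
    rewrite /bad E1 E2 /ep /wk /hk expr0 !divr1 -mulrA.
    have -> : (2 * (W * H))^-1 * (W * H) = 2^-1 by field; rewrite ?gt_eqF ?gt_eqF//.
    by have : 0 < `|Phi a1 a2 b1 b2| by [rewrite normr_gt0]; lra.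
  have [? [? ?] [? ?]] := stepP k (q k) IH1 IH2; split => //.
  case: IH2 => aq _ qa [bq _ qb]; split.
  - exact: le_trans aq _.
  - by rewrite lerDl ltW.
  - exact: le_trans qa.
  split; first exact: le_trans bq _.
    by rewrite lerDl ltW.
  exact: le_trans qb.
have qS k : ((q k).1 <= (q k.+1).1 /\ (q k.+1).1 + wk k.+1 <= (q k).1 + wk k) /\
    ((q k).2 <= (q k.+1).2 /\ (q k.+1).2 + hk k.+1 <= (q k).2 + hk k).
  by have [b r] := qP k; have [_ ? ?] := stepP k (q k) b r.
have [x0 x0P] : exists x, forall k, (q k).1 <= x <= (q k).1 + wk k.
  apply: nested_segments => k; [by have [[]] := qS k|by have [[]] := qS k|].
  exact: ltW.
have [y0 y0P] : exists x, forall k, (q k).2 <= x <= (q k).2 + hk k.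
  apply: nested_segments => k; [by have [_ []] := qS k|by have [_ []] := qS k|].
  exact: ltW.
have [A [Px [Qy APQ]]] : exists A Px Qy : R, forall e : R,
    0 < e -> exists2 d : R, 0 < d & forall x' y',
    a1 <= x' <= a2 -> b1 <= y' <= b2 -> `|x' - x0| < d -> `|y' - y0| < d ->
    `|P x' y' - P x0 y0 - (Px * (x' - x0) + A * (y' - y0))|
       <= e * (`|x' - x0| + `|y' - y0|) /\
    `|Q x' y' - Q x0 y0 - (A * (x' - x0) + Qy * (y' - y0))|
       <= e * (`|x' - x0| + `|y' - y0|).
  have [_ [aq _ qa [bq _ qb]]] := qP 0.
  have /andP[qx xq] := x0P 0; have /andP[qy yq] := y0P 0.
  apply: closedPQ; apply/andP; split.
  - exact: le_trans aq qx.
  - exact: le_trans xq qa.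
  - exact: le_trans bq qy.
  - exact: le_trans yq qb.
(* chosen so that the bound of Phi_bound becomes ep times the area *)
pose e := ep * (W * H) / (2 * (W + H) ^+ 2).
have WpH : 0 < W + H by rewrite addr_gt0.
have e0 : 0 < e.
  by apply: divr_gt0; [exact: mulr_gt0 | rewrite mulr_gt0 ?exprn_gt0].
have [d d0 dP] := APQ e e0.
have [k [wd hd]] : exists k, wk k < d /\ hk k < d.
  have := @cvg_geometric R (W + H) 2^-1; rewrite ger0_norm//.
  rewrite invf_lt1// ltr1n => /(_ isT)/cvgr0Pnorm_lt/(_ d d0)[k _ kP].
  exists k; have := kP k (leqnn k); rewrite /geometric/= ger0_norm.
    rewrite exprVn mulrDl -/(wk k) -/(hk k).
    by have := wk0 k; have := hk0 k; lra.
  by rewrite mulr_ge0 ?exprn_ge0// ltW.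
have [b r] := qP k.
have := Phi_bound (ltW (wk0 k)) (ltW (hk0 k)) e0 r wd hd (x0P k) (y0P k) dP.
move: b; rewrite /bad => /lt_le_trans/[apply].
rewrite -[wk k + hk k]mulrDl expr_div_n mulf_div -expr2 mulrA.
set T := (X in _ / X) => bd; suff E : 2 * e * ((W + H) ^+ 2 / T) = ep * (W * H) / T.
  by move: bd; rewrite E ltxx.
by rewrite /e; field; rewrite /T ?expf_neq0//= ?gt_eqF.
Qed.

End goursat.
End closed_forms.

(** * Complex derivatives, the mean value property and the maximum principle *)

Section one_complex_variable.
Context {R : realType}.
Implicit Types (z w al : R[i]) (f g : R[i] -> R[i]) (s t : R).

Definition cis t : R[i] := (cos t +i* sin t)%C.

Lemma cmodE z : cmod z = Num.sqrt (complex.Re z ^+ 2 + complex.Im z ^+ 2).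
Proof. by case: z. Qed.

Lemma normC_cmod z : `|z| = (cmod z)%:C%C.
Proof. by rewrite normc_def cmodE. Qed.

Lemma cmodM z w : cmod (z * w) = cmod z * cmod w.
Proof. exact: ComplexField.Normc.normcM. Qed.

Lemma ler_cmodD z w : cmod (z + w) <= cmod z + cmod w.
Proof. exact: le_normcD. Qed.

Lemma cmodN z : cmod (- z) = cmod z.
Proof. exact: normcN. Qed.

Lemma cmod_ge0 z : 0 <= cmod z.
Proof. by rewrite cmodE sqrtr_ge0. Qed.

Lemma cmod0 : cmod (0 : R[i]) = 0.
Proof. exact: ComplexField.Normc.normc0. Qed.

Lemma cmod1 : cmod (1 : R[i]) = 1.
Proof. exact: ComplexField.Normc.normc1. Qed.

Lemma cmodR s : cmod (s%:C)%C = `|s|.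
Proof. by rewrite cmodE /= expr0n addr0 sqrtr_sqr. Qed.

Lemma cmod_cis t : cmod (cis t) = 1.
Proof. by rewrite cmodE /= cos2Dsin2 sqrtr1. Qed.

Lemma cisD s t : cis (s + t) = cis s * cis t.
Proof.
by apply/eqP; rewrite eq_complex /= cosD sinD; apply/andP; split; apply/eqP; ring.
Qed.

Lemma cis0 : cis 0 = 1.
Proof. by rewrite /cis cos0 sin0. Qed.

Lemma cis2pi : cis (2 * pi) = 1.
Proof. by rewrite /cis mulr_natl -[pi *+ 2]add0r cosD2pi sinD2pi cos0 sin0. Qed.

Lemma ler_Re_cmod z : `|complex.Re z| <= cmod z.
Proof.
by rewrite cmodE -sqrtr_sqr ler_sqrt ?lerDl ?sqr_ge0// addr_ge0 ?sqr_ge0.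
Qed.

Lemma ler_Im_cmod z : `|complex.Im z| <= cmod z.
Proof.
by rewrite cmodE -sqrtr_sqr ler_sqrt ?lerDr ?sqr_ge0// addr_ge0 ?sqr_ge0.
Qed.

Lemma ler_cmod_ReIm z : cmod z <= `|complex.Re z| + `|complex.Im z|.
Proof.
rewrite [X in cmod X]complexE (le_trans (ler_cmodD _ _))// cmodM !cmodR.
by rewrite cmodE/= expr0n expr1n add0r sqrtr1 mul1r.
Qed.

Lemma le_cmodB z w : `|cmod w - cmod z| <= cmod (w - z).
Proof.
have h1 : cmod w <= cmod (w - z) + cmod z by rewrite -{1}(subrK z w) ler_cmodD.
have h2 : cmod z <= cmod (w - z) + cmod w.
  by rewrite -(cmodN (w - z)) opprB -{1}(subrK w z) ler_cmodD.
by rewrite ler_norml; lra.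
Qed.

(** The norm of [R[i]] takes its values in [R[i]]; this is complex
    differentiability in terms of the real-valued modulus. *)
Definition has_cderiv f z al : Prop := forall e : R, 0 < e ->
  exists2 d : R, 0 < d & forall w, cmod (w - z) < d ->
    cmod (f w - f z - al * (w - z)) <= e * cmod (w - z).

Lemma differentiable_cderiv f z : differentiable f z -> exists al, has_cderiv f z al.
Proof.
move=> /derivable1_diffP df; exists ('D_1 f z) => e e0.
have /cvgrPdist_le /(_ (e%:C)%C) := df.
rewrite ltcR => /(_ e0)/=; rewrite /dnbhs/= => H.
move: H => /nbhs_ballP[d /= d0 H].
have [dr dE] : exists dr, d = (dr%:C)%C.
  by apply/complex_realP/gtr0_real.
rewrite dE ltcR in d0; exists dr => // w wz.
have [->|wz0] := eqVneq w z; first by rewrite !subrr mulr0 subrr cmod0 mulr0.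
have wz0' : w - z != 0 by rewrite subr_eq0.
have := H (w - z); rewrite /ball/= sub0r normrN normC_cmod dE ltcR => /(_ wz wz0').
rewrite /GRing.scale/= mulr1 subrK normC_cmod lecR => {}H.
have -> : f w - f z - 'D_1 f z * (w - z) =
    - ('D_1 f z - (w - z)^-1 * (f w - f z)) * (w - z).
  by field.
by rewrite cmodM cmodN ler_wpM2r// cmod_ge0.
Qed.

Lemma derive_expansion (u : R -> R) (x du : R) : is_derive x 1 u du ->
  forall e : R, 0 < e -> exists2 d : R, 0 < d & forall h, `|h| < d ->
    `|u (x + h) - u x - du * h| <= e * `|h|.
Proof.
move=> [du1 du2] e e0; have /cvgrPdist_le /(_ e e0)/= := du1.
rewrite -/('D_1 u x) du2 /dnbhs/= => /nbhs_ballP[d /= d0 H].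
exists d => // h hd; have [->|h0] := eqVneq h 0.
  by rewrite addr0 mulr0 subrr subr0 normr0 mulr0.
have := H h; rewrite /ball/= sub0r normrN => /(_ hd h0).
rewrite /GRing.scale/= mulr1 [h + x]addrC => {}H.
have -> : u (x + h) - u x - du * h = - (du - h^-1 * (u (x + h) - u x)) * h.
  by field.
by rewrite normrM normrN ler_wpM2r.
Qed.

(** The complex exponential of [s + i t]. *)
Definition cexp s t : R[i] := (expR s)%:C%C * cis t.

Lemma cexpD s t h k : cexp (s + h) (t + k) = cexp s t * cexp h k.
Proof. by rewrite /cexp expRD cisD rmorphM/= mulrACA. Qed.

Lemma cmod_cexp s t : cmod (cexp s t) = expR s.
Proof. by rewrite cmodM cmodR cmod_cis mulr1 ger0_norm// expR_ge0. Qed.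

Lemma cexp_expansion0 (e : R) : 0 < e -> exists2 d : R, 0 < d & forall h k,
  `|h| < d -> `|k| < d ->
  cmod (cexp h k - 1 - (h +i* k)%C) <= e * (`|h| + `|k|).
Proof.
move=> e0; pose e' := e / 8; have e'0 : 0 < e' by rewrite divr_gt0.
have [d1 d10 H1] := derive_expansion (is_derive_expR 0) e'0.
have [d2 d20 H2] := derive_expansion (is_derive_cos 0) e'0.
have [d3 d30 H3] := derive_expansion (is_derive_sin 0) e'0.
have [d4 d40 H4] := derive_expansion (is_derive_expR 0) (@ltr01 R).
exists (Num.min (Num.min d1 d2) (Num.min (Num.min d3 d4) (Num.min (2^-1) e'))).
  by rewrite !lt_min !d10 !d20 !d30 !d40 e'0 invr_gt0 ltr0n.
move=> h k; rewrite !lt_min => /and3P[/andP[hd1 hd2] /andP[hd3 hd4] /andP[hd5 hd6]].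
move=> /and3P[/andP[kd1 kd2] /andP[kd3 kd4] /andP[kd5 kd6]].
have := H1 h hd1; have := H2 k kd2; have := H3 k kd3; have := H4 h hd4.
rewrite !add0r expR0 cos0 sin0 subr0 oppr0 mul0r subr0 !mul1r => A4 A3 A2 A1.
apply: le_trans (ler_cmod_ReIm _) _; rewrite /cexp /=.
set E := expR h in A1 A4 *; set c := cos k in A2 *; set s := sin k in A3 *.
have E1 : `|E - 1| <= 2 * `|h|.
  have -> : E - 1 = (E - 1 - h) + h by ring.
  by rewrite (le_trans (ler_normD _ _))//; lra.
have E2 : `|E| <= 2.
  have -> : E = (E - 1) + 1 by ring.
  by rewrite (le_trans (ler_normD _ _))// normr1; lra.
have -> : E * c - 0 * s - 1 - h = E * (c - 1) + (E - 1 - h) by ring.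
have -> : E * s + 0 * c - 0 - k = E * (s - k) + (E - 1) * k by ring.
have B1 : `|E * (c - 1)| <= 2 * (e' * `|k|) by rewrite normrM ler_pM.
have B2 : `|E * (s - k)| <= 2 * (e' * `|k|) by rewrite normrM ler_pM.
have B3 : `|(E - 1) * k| <= 2 * e' * `|k|.
  by rewrite normrM ler_wpM2r// (le_trans E1)//; lra.
have := ler_normD (E * (c - 1)) (E - 1 - h).
have := ler_normD (E * (s - k)) ((E - 1) * k).
have k0 := mulr_ge0 (ltW e0) (normr_ge0 k).
have h0 := mulr_ge0 (ltW e0) (normr_ge0 h).
by move: A1 B1 B2 B3; rewrite /e'; lra.
Qed.

(** That the derivative [B] acts on [h + i k] by complex multiplication is the
    Cauchy-Riemann equations for [f \o exp]: they make the imaginary part of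
    [f (exp (s + i t)) (ds + i dt)] a closed form. *)
Lemma strip_expansion f s0 t0 al : has_cderiv f (cexp s0 t0) al ->
  exists B, forall e : R, 0 < e -> exists2 d : R, 0 < d & forall h k,
  `|h| < d -> `|k| < d ->
  cmod (f (cexp (s0 + h) (t0 + k)) - f (cexp s0 t0) - B * (h +i* k)%C)
    <= e * (`|h| + `|k|).
Proof.
set z0 := cexp s0 t0 => fz; exists (al * z0) => e e0.
have [a [a0 ale]] : exists a : R, 0 < a /\ cmod al <= a.
  by exists (cmod al + 1); rewrite lerDl ler01 ltr_wpDl// cmod_ge0.
have [b [b0 z0b]] : exists b : R, 0 < b /\ cmod z0 <= b.
  by exists (cmod z0 + 1); rewrite lerDl ler01 ltr_wpDl// cmod_ge0.
have anz : a != 0 by rewrite gt_eqF.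
have bnz : b != 0 by rewrite gt_eqF.
pose e2 := Num.min 1 (e / (2 * a * b)).
have e20 : 0 < e2 by rewrite lt_min ltr01 divr_gt0// !mulr_gt0.
pose e1 := e / (4 * b).
have e10 : 0 < e1 by rewrite divr_gt0// mulr_gt0.
have [d1 d10 H1] := fz e1 e10.
have [d2 d20 H2] := cexp_expansion0 e20.
pose d3 := d1 / (4 * b).
have d30 : 0 < d3 by rewrite divr_gt0// mulr_gt0.
exists (Num.min d2 d3); first by rewrite lt_min d20.
move=> h k; rewrite !lt_min => /andP[hd2 hd3] /andP[kd2 kd3].
rewrite cexpD -/z0; set q := cexp h k; set u := (h +i* k)%C.
have A : cmod (q - 1 - u) <= e2 * (`|h| + `|k|) := H2 h k hd2 kd2.
have hk0 : 0 <= `|h| + `|k| by rewrite addr_ge0.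
have A1 : cmod (q - 1 - u) <= `|h| + `|k|.
  by rewrite (le_trans A)// -[leRHS]mul1r ler_wpM2r// ge_min lexx.
have A2 : cmod (q - 1) <= 2 * (`|h| + `|k|).
  have -> : q - 1 = (q - 1 - u) + u by ring.
  rewrite (le_trans (ler_cmodD _ _))//.
  by have u1 : cmod u <= `|h| + `|k| := ler_cmod_ReIm u; lra.
have Z : cmod (z0 * q - z0) <= b * (2 * (`|h| + `|k|)).
  have -> : z0 * q - z0 = z0 * (q - 1) by ring.
  by rewrite cmodM ler_pM ?cmod_ge0.
have Zd : cmod (z0 * q - z0) < d1.
  apply: le_lt_trans Z _.
  have -> : d1 = b * (4 * d3) by rewrite /d3; field.
  by rewrite ltr_pM2l//; lra.
have {}H1 := H1 _ Zd.
have -> : f (z0 * q) - f z0 - al * z0 * u =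
  (f (z0 * q) - f z0 - al * (z0 * q - z0)) + al * z0 * (q - 1 - u) by ring.
rewrite (le_trans (ler_cmodD _ _))//.
have -> : e * (`|h| + `|k|) = e / 2 * (`|h| + `|k|) + e / 2 * (`|h| + `|k|).
  by lra.
apply: lerD.
  rewrite (le_trans H1)//.
  have -> : e / 2 * (`|h| + `|k|) = e1 * (b * (2 * (`|h| + `|k|))).
    by rewrite /e1; field.
  by rewrite ler_wpM2l// ltW.
have -> : e / 2 * (`|h| + `|k|) = a * b * (e / (2 * a * b) * (`|h| + `|k|)).
  by field; rewrite ?anz ?bnz.
have alz0 : cmod al * cmod z0 <= a * b by apply: ler_pM => //; exact: cmod_ge0.
rewrite cmodM [cmod (al * z0)]cmodM; apply: ler_pM; rewrite ?mulr_ge0 ?cmod_ge0//.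
by rewrite (le_trans A)// ler_wpM2r// ge_min lexx orbT.
Qed.


Section disc.
Variable f : R[i] -> R[i].
Hypothesis holf : forall z, cmod z <= 1 -> exists al, has_cderiv f z al.

Let expR_le1 s : s <= 0 -> expR s <= 1.
Proof. by move=> s0; rewrite -expR0 ler_expR. Qed.

Let strip s t : s <= 0 -> exists B, forall e : R, 0 < e ->
  exists2 d : R, 0 < d & forall h k, `|h| < d -> `|k| < d ->
  cmod (f (cexp (s + h) (t + k)) - f (cexp s t) - B * (h +i* k)%C)
    <= e * (`|h| + `|k|).
Proof.
move=> s0; have [|al] := holf (z := cexp s t).
  by rewrite cmod_cexp expR_le1.
exact: strip_expansion.
Qed.

Let strip_cont s t : s <= 0 -> forall e : R, 0 < e ->
  exists2 d : R, 0 < d & forall h k, `|h| < d -> `|k| < d ->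
  cmod (f (cexp (s + h) (t + k)) - f (cexp s t)) <= e.
Proof.
move=> s0 e e0; have [B /(_ 1 ltr01)[d d0 dP]] := strip t s0.
pose b := cmod B + 1; have b0 : 0 < b by rewrite ltr_wpDl// cmod_ge0.
exists (Num.min d (e / (2 * b))); first by rewrite lt_min d0 divr_gt0// mulr_gt0.
move=> h k; rewrite !lt_min => /andP[hd he] /andP[kd ke].
have := dP h k hd kd; set X := f _ - f _; set u := (h +i* k)%C => XP.
have u1 : cmod u <= `|h| + `|k| := ler_cmod_ReIm u.
have Bu : cmod (B * u) <= cmod B * (`|h| + `|k|).
  by rewrite cmodM ler_wpM2l// cmod_ge0.
have -> : X = (X - B * u) + B * u by ring.
rewrite (le_trans (ler_cmodD _ _))//.
have : b * (`|h| + `|k|) <= b * (e / b).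
  rewrite ler_wpM2l ?(ltW b0)//.
  have -> : e / b = e / (2 * b) + e / (2 * b) by field; rewrite gt_eqF.
  by rewrite ltW// ltrD.
rewrite mulrCA divff ?gt_eqF// mulr1 /b; lra.
Qed.

Let continuous_strip1 (L : R[i] -> R) t :
  (forall z w, L (z - w) = L z - L w) -> (forall z, `|L z| <= cmod z) ->
  forall a b, b <= 0 -> {within `[a, b], continuous (fun s => L (f (cexp s t)))}.
Proof.
move=> LB Lle a b b0; apply: continuous_in_subspaceT => s.
rewrite inE/= in_itv/= => /andP[_ sb]; apply/cvgrPdist_le => e e0.
have [//|d d0 dP] := strip_cont t (le_trans sb b0) (e := e).
apply/nbhs_ballP; exists d => // s'; rewrite /ball/= => ss'.
rewrite distrC -LB (le_trans (Lle _))//.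
have := dP (s' - s) 0; rewrite addr0 [s + _]addrC subrK normr0; apply => //.
by rewrite distrC.
Qed.

Let continuous_strip2 (L : R[i] -> R) s :
  (forall z w, L (z - w) = L z - L w) -> (forall z, `|L z| <= cmod z) ->
  forall a b, s <= 0 -> {within `[a, b], continuous (fun t => L (f (cexp s t)))}.
Proof.
move=> LB Lle a b s0; apply: continuous_in_subspaceT => t _.
apply/cvgrPdist_le => e e0.
have [//|d d0 dP] := strip_cont t s0 (e := e).
apply/nbhs_ballP; exists d => // t'; rewrite /ball/= => tt'.
rewrite distrC -LB (le_trans (Lle _))//.
have := dP 0 (t' - t); rewrite addr0 [t + _]addrC subrK normr0; apply => //.
by rewrite distrC.
Qed.

Let ReB z w : complex.Re (z - w) = complex.Re z - complex.Re w.
Proof. by case: z w => [? ?] [? ?]. Qed.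

Let ImB z w : complex.Im (z - w) = complex.Im z - complex.Im w.
Proof. by case: z w => [? ?] [? ?]. Qed.

Let Q s t := complex.Re (f (cexp s t)).

(** Goursat's theorem on the rectangle [[s, 0] x [0, 2 pi]]: by periodicity in
    [t] the two horizontal sides cancel. *)
Lemma circle_integral_const s : s < 0 ->
  \int[lebesgue_measure]_(t in `[0, 2 * pi]) Q 0 t =
  \int[lebesgue_measure]_(t in `[0, 2 * pi]) Q s t.
Proof.
move=> s0; pose P s t := complex.Im (f (cexp s t)).
have pi20 : 0 < 2 * pi :> R by rewrite mulr_gt0// pi_gt0.
have := @goursat R P Q s 0 0 (2 * pi) s0 pi20.
have -> : P^~ (2 * pi) = P^~ 0.
  by apply/funext => x; rewrite /P /cexp cis2pi cis0.
have intP y : (lebesgue_measure).-integrable `[s, 0] (EFin \o P^~ y).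
  apply: continuous_compact_integrable; first exact: segment_compact.
  by apply: continuous_strip1 => //; exact: ler_Im_cmod.
have intQ x : x <= 0 -> (lebesgue_measure).-integrable `[0, 2 * pi] (EFin \o Q x).
  move=> x0; apply: continuous_compact_integrable; first exact: segment_compact.
  by apply: continuous_strip2 => //; exact: ler_Re_cmod.
move=> /(_ (fun y _ => intP y)).
move=> /(_ (fun x => fun h : s <= x <= 0 => intQ x (proj2 (andP h)))).
move=> H; apply: (addrI _ (H _)) => {H} x y /andP[_ x0] _.
have [[b1 b2] BP] := strip y x0.
exists b1, b2, (- b2) => e e0; have [d d0 dP] := BP e e0.
exists d => // x' y' _ _ xx' yy'; have := dP _ _ xx' yy'.
rewrite [x + _]addrC [y + _]addrC !subrK => {}dP.
split.
  rewrite (le_trans _ dP)// (le_trans _ (ler_Im_cmod _))// !ImB /P /=.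
  by rewrite [leLHS](_ : _ = `|complex.Im (f (cexp x' y')) -
    complex.Im (f (cexp x y)) - (b1 * (y' - y) + b2 * (x' - x))|)//;
    congr (`|_|); ring.
rewrite (le_trans _ dP)// (le_trans _ (ler_Re_cmod _))// !ReB /Q /=.
by rewrite [leLHS](_ : _ = `|complex.Re (f (cexp x' y')) -
    complex.Re (f (cexp x y)) - (b1 * (x' - x) - b2 * (y' - y))|)//;
    congr (`|_|); ring.
Qed.

(** The circle mean does not depend on the radius [exp s], and it tends to
    [Re (f 0)] when [s] tends to [-oo] because [f] is continuous at [0]. *)
Lemma mean_value_Re :
  \int[lebesgue_measure]_(t in `[0, 2 * pi]) complex.Re (f (cis t)) =
  2 * pi * complex.Re (f 0).
Proof.
have pi20 : 0 < 2 * pi :> R by rewrite mulr_gt0// pi_gt0.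
have Q0 t : Q 0 t = complex.Re (f (cis t)).
  by rewrite /Q /cexp expR0 mul1r.
under eq_Rintegral do rewrite -Q0.
set I := (X in X = _).
apply/eqP; rewrite -subr_eq0 -normr_le0 -[leRHS](mul0r (2 * pi)).
apply/ler_addgt0Pl => e e0; rewrite mul0r addr0.
have [al /(_ 1 ltr01)[d d0 dP]] := holf (z := 0) (eq_ind_r (fun x => x <= 1) ler01 cmod0).
pose a := cmod al + 1; have a0 : 0 < a by rewrite ltr_wpDl// cmod_ge0.
(* a bounds the difference quotients of f at 0, so that f differs from f 0 by
   at most e / (2 pi) in the disc of radius r *)
pose r := Num.min (Num.min d (2^-1)) (e / (2 * pi) / a).
have r0 : 0 < r by rewrite !lt_min d0 invr_gt0 ltr0n !divr_gt0.
pose s := ln (r / 2).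
have rs : expR s = r / 2 by rewrite lnK// posrE divr_gt0.
have rle : r / 2 < r by lra.
have s0 : s < 0.
  rewrite ln_lt0// divr_gt0//=; apply: lt_le_trans rle _.
  by rewrite /r ge_min ge_min; apply/orP; left; apply/orP; right; lra.
have {I}-> : I = \int[lebesgue_measure]_(t in `[0, 2 * pi]) Q s t.
  exact: circle_integral_const.
have := @Rintegral_itv_near R 0 (2 * pi) (Q s) (complex.Re (f 0)) (e / (2 * pi)).
rewrite subr0 divfK ?gt_eqF// [_ * (2 * pi)]mulrC; apply; first exact: ltW.
  apply: continuous_compact_integrable; first exact: segment_compact.
  by apply: continuous_strip2 => //; [exact: ler_Re_cmod|exact: ltW].
move=> t _; rewrite /Q -ReB (le_trans (ler_Re_cmod _))//.
set z := cexp s t.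
have zr : cmod z < r by rewrite cmod_cexp rs.
have zd : cmod (z - 0) < d.
  by rewrite subr0 (lt_le_trans zr)// /r ge_min ge_min lexx.
have := dP z zd; rewrite subr0 mul1r; set X := f z - f 0 => XP.
have -> : X = (X - al * z) + al * z by ring.
rewrite (le_trans (ler_cmodD _ _))// cmodM.
have : a * cmod z <= a * (e / (2 * pi) / a).
  by rewrite ler_wpM2l ?(ltW a0)// ltW// (lt_le_trans zr)// /r ge_min lexx orbT.
rewrite mulrCA divff ?gt_eqF// mulr1 /a; lra.
Qed.

Lemma circle_Re_max : exists2 t, 0 <= t <= 2 * pi &
  complex.Re (f 0) <= complex.Re (f (cis t)).
Proof.
have pi20 : 0 < 2 * pi :> R by rewrite mulr_gt0// pi_gt0.
have Q0 t : Q 0 t = complex.Re (f (cis t)).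
  by rewrite /Q /cexp expR0 mul1r.
have ctn : {within `[0, 2 * pi], continuous (Q 0)}.
  by apply: continuous_strip2 => //; exact: ler_Re_cmod.
have [c cI cP] := EVT_max (ltW pi20) ctn.
exists c; first by move: cI; rewrite in_itv.
rewrite -(ler_pM2l pi20) -mean_value_Re -Q0.
under eq_Rintegral do rewrite -Q0.
rewrite [leRHS](_ : _ = Q 0 c * (2 * pi - 0)); last by rewrite subr0 mulrC.
apply: Rintegral_itv_le; first exact: ltW.
  by apply: continuous_compact_integrable; first exact: segment_compact.
by move=> x xI; apply: cP; rewrite in_itv.
Qed.

End disc.

(** Multiplying [f] by the conjugate of [f 0] makes the value at [0] real, so
    that the mean value property of real parts suffices. *)
Lemma max_modulus f : (forall z, cmod z <= 1 -> differentiable f z) ->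
  exists2 t, 0 <= t <= 2 * pi & cmod (f 0) <= cmod (f (cis t)).
Proof.
move=> df; set c := (f 0)^*%C.
have [t tI tP] : exists2 t, 0 <= t <= 2 * pi &
    complex.Re (c * f 0) <= complex.Re (c * f (cis t)).
  apply: (@circle_Re_max (fun z => c * f z)) => z z1.
  apply: differentiable_cderiv; apply: differentiableM => //.
  exact: df.
exists t => //; have [->|f0] := eqVneq (f 0) 0; first by rewrite cmod0 cmod_ge0.
have f00 : 0 < cmod (f 0).
  rewrite lt_def cmod_ge0 andbT; apply: contra f0 => /eqP h.
  by apply/eqP; exact: ComplexField.Normc.eq0_normc.
have cE : cmod c = cmod (f 0).
  by rewrite /c; case: (f 0) => x y; rewrite !cmodE /= sqrrN.
have E : complex.Re (c * f 0) = cmod (f 0) ^+ 2.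
  rewrite /c cmodE sqr_sqrtr; last by rewrite addr_ge0 ?sqr_ge0.
  by case: (f 0) => x y /=; ring.
rewrite -(ler_pM2l f00) -expr2 -E -cE -cmodM (le_trans tP)//.
by rewrite (le_trans (ler_norm _))// ler_Re_cmod.
Qed.

Lemma differentiable_bigprod (I : Type) (r : seq I) (F : I -> R[i] -> R[i]) z :
  (forall i, differentiable (F i) z) ->
  differentiable (fun x => \prod_(i <- r) F i x) z.
Proof.
move=> dF; elim: r => [|i r IH].
  by under eq_fun do rewrite big_nil; exact: differentiable_cst.
under eq_fun do rewrite big_cons.
exact: differentiableM.
Qed.

Lemma cmod_prod (I : Type) (r : seq I) (F : I -> R[i]) :
  cmod (\prod_(i <- r) F i) = \prod_(i <- r) cmod (F i).
Proof. by apply: big_morph; [exact: cmodM|exact: cmod1]. Qed.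

(** The maximum principle for [\prod_k f (w_k z)] with [w_k] the [N]-th roots
    of unity.  The modulus of this product is invariant under rotation by
    [2 pi / N], which is why the maximum can be found at an angle in the first
    arc; the factors then sample each of the [N] arcs exactly once. *)
Lemma max_modulus_prod f (N : nat) : (0 < N)%N ->
  (forall z, cmod z <= 1 -> differentiable f z) ->
  exists2 t, 0 <= t <= 2 * pi / N%:R &
    cmod (f 0) ^+ N <= \prod_(k < N) cmod (f (cis (t + 2 * pi * k%:R / N%:R))).
Proof.
move=> N0 df; pose w (k : nat) := 2 * pi * k%:R / N%:R : R.
have Nr0 : 0 < N%:R :> R by rewrite ltr0n.
have pi20 : 0 < 2 * pi :> R by rewrite mulr_gt0// pi_gt0.
pose F z := \prod_(k < N) f (cis (w k) * z).
pose G t := \prod_(k < N) cmod (f (cis (t + w k))).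
have [z z1|t tI] := @max_modulus F.
  apply: differentiable_bigprod => k; apply: differentiable_comp.
    exact: differentiableM.
  by apply: df; rewrite cmodM cmod_cis mul1r.
rewrite /F [in leLHS](eq_bigr (fun=> f 0)); last by move=> k _; rewrite mulr0.
rewrite !cmod_prod prodr_const card_ord.
have -> : \prod_(k < N) cmod (f (cis (w k) * cis t)) = G t.
  by apply: eq_bigr => k _; rewrite -cisD addrC.
have wN : w N = 2 * pi by rewrite /w mulfK ?gt_eqF.
have w0 : w 0 = 0 by rewrite /w mulr0 mul0r.
have wS k : w k.+1 = w 1 + w k by rewrite /w -natr1; field; rewrite gt_eqF.
have GS u : G (u + w 1) = G u.
  rewrite /G; case: N N0 {F G df Nr0} @w wN w0 wS => // n _ w wN w0 wS.
  rewrite [in LHS]big_ord_recr [in RHS]big_ord_recl /= mulrC; congr (_ * _).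
    by rewrite -addrA -wS wN w0 addr0 cisD cis2pi mulr1.
  by apply: eq_bigr => i _; rewrite -addrA -wS.
have GD j u : G (u + w j) = G u.
  elim: j u => [|j IH] u; first by rewrite w0 addr0.
  by rewrite wS addrA IH GS.
pose x := t / w 1.
have w10 : 0 < w 1 by rewrite /w mulr1 divr_gt0.
have /andP[t0 t2] := tI.
have /truncn_itv/andP[jx xj] : 0 <= x by rewrite divr_ge0// ltW.
set j := Num.truncn x in jx xj.
have wj : w j = j%:R * w 1 by rewrite /w; field; rewrite gt_eqF.
(* j is the index of the arc containing t; rotating back by j arcs leaves G
   unchanged *)
rewrite -(subrK (w j) t) GD => H; exists (t - w j) => //.
have -> : 2 * pi / N%:R = w 1 by rewrite /w mulr1.
rewrite subr_ge0 lerBlDl wj -[X in _ * _ + X]mul1r -mulrDl natr1.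
by rewrite -ler_pdivlMr// jx -ler_pdivrMr// ltW.
Qed.

End one_complex_variable.

(** * Sub-mean value property of powers of the modulus, along roots of unity *)

Section powers_of_modulus.
Context {R : realType}.
Implicit Types (f : R[i] -> R[i]) (v : R[i] -> R) (y z w : R[i]).

(** Continuity at [y] in terms of the real-valued modulus, for the same reason
    as in [has_cderiv]. *)
Definition cmod_continuous v y := forall e : R, 0 < e ->
  exists2 d : R, 0 < d & forall w, cmod (w - y) < d -> `|v w - v y| <= e.

(** Only nonnegative [s'] are allowed: [powR] is [1] on negative reals, hence
    discontinuous at [0]. *)
Lemma powR_continuous_ge0 (p s e : R) : 0 < p -> 0 <= s -> 0 < e ->
  exists2 d : R, 0 < d & forall s', 0 <= s' -> `|s' - s| < d ->
    `|s' `^ p - s `^ p| <= e.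
Proof.
move=> p0; rewrite le_eqVlt => /predU1P[<-|s0] e0.
  exists (e `^ p^-1); first exact: powR_gt0.
  move=> s' s'0; rewrite subr0 ger0_norm// => s'e.
  rewrite powR0 ?gt_eqF// subr0 ger0_norm ?powR_ge0//.
  have -> : e = (e `^ p^-1) `^ p.
    by rewrite -powRrM mulVf ?gt_eqF// powRr1// ltW.
  by rewrite ge0_ler_powR ?ltW// nnegrE ?powR_ge0.
have /derivable1_diffP/differentiable_continuous : derivable (@powR R ^~ p) s 1.
  by apply: derivable_powR; rewrite in_itv/= s0.
move=> /cvgrPdist_le/(_ e e0)/nbhs_ballP[d /= d0 H].
exists d => // s' _ s's; rewrite distrC; apply: H.
by rewrite /ball/= distrC.
Qed.

Lemma cmod_powR_continuous f z (p : R) : 0 < p -> differentiable f z ->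
  cmod_continuous (fun w => cmod (f w) `^ p) z.
Proof.
move=> p0 /differentiable_cderiv[al fz] e e0.
have [d1 d10 H1] := powR_continuous_ge0 p0 (cmod_ge0 (f z)) e0.
have [d2 d20 H2] := fz 1 ltr01.
have [b [b0 ale]] : exists b : R, 0 < b /\ cmod al + 1 < b.
  by exists (cmod al + 2); split; [rewrite ltr_wpDl// cmod_ge0|lra].
exists (Num.min d2 (d1 / b)); first by rewrite lt_min d20 divr_gt0.
move=> w; rewrite lt_min => /andP[wd2 wd1]; apply: H1; first exact: cmod_ge0.
apply: le_lt_trans (le_cmodB _ _) _.
have -> : f w - f z = (f w - f z - al * (w - z)) + al * (w - z) by ring.
apply: le_lt_trans (ler_cmodD _ _) _; rewrite cmodM.
have h := H2 w wd2; rewrite mul1r in h.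
have h' : b * cmod (w - z) < d1 by rewrite mulrC -ltr_pdivlMr.
have h'' : (cmod al + 1) * cmod (w - z) <= b * cmod (w - z).
  by rewrite ler_wpM2r ?cmod_ge0// ltW.
by lra.
Qed.

Lemma cis_near1 : exists2 d : R, 0 < d & forall t : R, `|t| < d ->
  cmod (cis t - 1) <= 2 * `|t|.
Proof.
have [d d0 H] := cexp_expansion0 (@ltr01 R).
exists d => // t td; have := H 0 t; rewrite normr0 => /(_ d0 td).
rewrite /cexp expR0 mul1r add0r mul1r => {}H.
have -> : cis t - 1 = (cis t - 1 - (0 +i* t)%C) + (0 +i* t)%C by ring.
rewrite (le_trans (ler_cmodD _ _))//.
have : cmod (0 +i* t)%C <= `|0 : R| + `|t| := ler_cmod_ReIm _.
by rewrite normr0; lra.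
Qed.

(** Uniform continuity, by compactness of the square that contains the disc of
    radius [rho] and lies in the disc of radius [2 * rho]. *)
Lemma small_rotation_unif v (rho : R) : 0 < rho ->
  (forall y, cmod y <= 2 * rho -> cmod_continuous v y) ->
  forall e : R, 0 < e -> exists2 N, (0 < N)%N & forall y t, cmod y <= rho ->
    0 <= t <= 2 * pi / N%:R -> `|v (cis t * y) - v y| <= e.
Proof.
move=> rho0 vc e e0.
pose K : set (R * R)%type := `[- rho, rho] `*` `[- rho, rho].
have cK : compact K by apply: compact_setX; exact: segment_compact.
pose P (N : nat) (q : R * R) := forall t, 0 <= t <= 2 * pi / N%:R ->
  cmod (q.1 +i* q.2)%C <= rho ->
  `|v (cis t * (q.1 +i* q.2)%C) - v (q.1 +i* q.2)%C| <= e.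
have pi20 : 0 < 2 * pi :> R by rewrite mulr_gt0// pi_gt0.
have : \forall N \near \oo, K `<=` P N.
  apply: (compact_near_coveringP _).1 => // -[x y] [/= xK yK].
  pose z := (x +i* y)%C.
  have zrho : cmod z <= 2 * rho.
    have zxy : cmod z <= `|x| + `|y| := ler_cmod_ReIm z.
    apply: le_trans zxy _; move: xK yK; rewrite !in_itv -!ler_norml; lra.
  have e20 : 0 < e / 2 by lra.
  have [d d0 dP] := vc z zrho _ e20.
  have [d1 d10 hcis] := cis_near1.
  pose d2 := Num.min d1 (d / (4 * rho)).
  have d20 : 0 < d2 by rewrite lt_min d10 divr_gt0// mulr_gt0.
  exists (ball (x, y) (d / 4), [set N : nat | (0 < N)%N /\ 2 * pi / N%:R < d2]).
    split => /=; first by apply: nbhsx_ballx; lra.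
    exists (Num.truncn (2 * pi / d2)).+1 => // N /= hN.
    have N0 : (0 < N)%N by apply: leq_trans hN.
    split => //; rewrite ltr_pdivrMr ?ltr0n// [_ * N%:R]mulrC -ltr_pdivrMr//.
    by apply: lt_le_trans (truncnS_gt (2 * pi / d2)) _; rewrite ler_nat.
  move=> [[x' y'] N] [/= [bx hby] [N0 Nd]] t /andP[t0 tN] /= zr.
  set z' := (x' +i* y')%C.
  have z'z : cmod (z' - z) < d / 2.
    have zxy : cmod (z' - z) <= `|x' - x| + `|y' - y| := ler_cmod_ReIm _.
    apply: le_lt_trans zxy _; move: bx hby.
    by rewrite /ball/= (distrC x) (distrC y); lra.
  have td : `|t| < d2 by rewrite ger0_norm// (le_lt_trans tN).
  have /hcis ct : `|t| < d1 by rewrite (lt_le_trans td)// ge_min lexx.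
  have cz : cmod (cis t * z' - z') < d / 2.
    have -> : cis t * z' - z' = (cis t - 1) * z' by ring.
    rewrite cmodM; apply: (@le_lt_trans _ _ (2 * `|t| * rho)).
      by apply: ler_pM; rewrite ?cmod_ge0.
    have : `|t| < d / (4 * rho) by rewrite (lt_le_trans td)// ge_min lexx orbT.
    rewrite ltr_pdivlMr ?mulr_gt0//; lra.
  have A1 : `|v z' - v z| <= e / 2 by apply: dP; lra.
  have A2 : `|v (cis t * z') - v z| <= e / 2.
    apply: dP; have -> : cis t * z' - z = (cis t * z' - z') + (z' - z) by ring.
    by apply: le_lt_trans (ler_cmodD _ _) _; lra.
  by move: A1 A2; rewrite !ler_norml; lra.
move=> [M _ NP]; exists M.+1 => // -[x y] t zr tN.
have := NP M.+1 (leqnSn M) (x, y); apply => //.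
have h1 : `|x| <= cmod (x +i* y)%C := ler_Re_cmod (x +i* y)%C.
have h2 : `|y| <= cmod (x +i* y)%C := ler_Im_cmod (x +i* y)%C.
by split; rewrite /= in_itv/= -ler_norml; [exact: le_trans h1 zr|exact: le_trans h2 zr].
Qed.

Lemma powR_prod (I : Type) (r : seq I) (F : I -> R) (p : R) :
  (forall i, 0 <= F i) -> (\prod_(i <- r) F i) `^ p = \prod_(i <- r) (F i `^ p).
Proof.
move=> F0; elim: r => [|i r IH]; first by rewrite !big_nil powR1.
by rewrite !big_cons powRM ?IH// prodr_ge0.
Qed.

(** The arithmetic-geometric mean inequality applied to [max_modulus_prod]:
    a discrete form of the subharmonicity of [|f| ^ p], for each [p > 0]. *)
Lemma max_modulus_sum f (p : R) (N : nat) : 0 < p -> (0 < N)%N ->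
  (forall z, cmod z <= 1 -> differentiable f z) ->
  exists2 t, 0 <= t <= 2 * pi / N%:R & N%:R * cmod (f 0) `^ p <=
    \sum_(k < N) cmod (f (cis (t + 2 * pi * k%:R / N%:R))) `^ p.
Proof.
move=> p0 N0 df; have [t tI tP] := max_modulus_prod N0 df; exists t => //.
have Nr0 : 0 < N%:R :> R by rewrite ltr0n.
set F := fun k : 'I_N => cmod (f (cis (t + 2 * pi * k%:R / N%:R))).
have /(ge0_ler_powR (ltW p0)) := tP.
rewrite !nnegrE exprn_ge0 ?prodr_ge0 ?cmod_ge0// => [/(_ isT isT)|k _]; last exact: cmod_ge0.
rewrite powR_prod; last by move=> k; exact: cmod_ge0.
have -> : (cmod (f 0) ^+ N) `^ p = (cmod (f 0) `^ p) ^+ N.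
  by rewrite -powR_mulrn ?cmod_ge0// -powRrM mulrC powRrM powR_mulrn ?powR_ge0.
move=> H; have := leif_AGM (A := predT) (E := fun k : 'I_N => F k `^ p).
rewrite cardT size_enum_ord => /(_ _)[|+ _]; first by move=> k _; exact: powR_ge0.
move=> /(le_trans H); rewrite ler_pXn2r// ?nnegrE ?powR_ge0//; last first.
  by rewrite divr_ge0 ?sumr_ge0 ?ltW// => k _; exact: powR_ge0.
by rewrite ler_pdivlMr// mulrC.
Qed.

(** In [max_modulus_sum] the good angle [t] depends on [x]; as it is at most
    [2 pi / N], uniform continuity removes it at the price of [e], and the
    average over the rotates of [x] itself bounds [|f a| ^ p]. *)
Lemma rotation_average f (a : R[i]) (p rho e : R) : 0 < p -> 0 < rho -> 0 < e ->
  (forall z, cmod (z - a) <= 2 * rho -> differentiable f z) ->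
  exists2 N, (0 < N)%N & forall x, cmod x <= rho ->
    N%:R * cmod (f a) `^ p <=
    \sum_(k < N) (cmod (f (a + cis (2 * pi * k%:R / N%:R) * x)) `^ p + e).
Proof.
move=> p0 rho0 e0 df; pose v y := cmod (f (a + y)) `^ p.
have [|N N0 NP] := @small_rotation_unif v rho rho0 _ e e0.
  move=> y yr e' e'0.
  have /(cmod_powR_continuous p0) /(_ e' e'0)[d d0 dP] : differentiable f (a + y).
    by apply: df; rewrite addrAC subrr add0r.
  exists d => // w wy; apply: dP.
  by have -> : a + w - (a + y) = w - y by ring.
exists N => // x xrho.
have [z z1|t tI tP] := @max_modulus_sum (fun z => f (a + z * x)) p N p0 N0.
  apply: (@differentiable_comp _ _ _ _ (fun z => a + z * x) f).
    by apply: differentiableD => //; apply: differentiableM.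
  apply: df; rewrite [a + _]addrC addrK cmodM.
  have := cmod_ge0 x; have := cmod_ge0 z; have : cmod z * cmod x <= 1 * cmod x.
    by rewrite ler_wpM2r// cmod_ge0.
  by lra.
rewrite mul0r addr0 in tP; rewrite (le_trans tP)//; apply: ler_sum => k _.
set w := 2 * pi * k%:R / N%:R.
have := NP (cis w * x) t; rewrite cmodM cmod_cis mul1r => /(_ xrho tI).
by rewrite mulrA -cisD /v ler_norml; lra.
Qed.

End powers_of_modulus.

(** * Rotation invariance of plane Lebesgue measure *)

Section plane_rotation.
Context {R : realType}.
Local Notation T := (measurableTypeR R).
Local Notation plane := (measurableTypeR R * measurableTypeR R)%type.
Local Notation mu := (@lebesgue_measure R).
Local Notation mu2 := (prod_measure mu mu).
Local Open Scope ereal_scope.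

Section translation.
Variable c : R.

Let shift (x : T) : T := (x + c)%R.

Let measurable_shift : measurable_fun [set: T] shift.
Proof. exact: measurable_funD. Qed.

Lemma lebesgue_measure_translation A : measurable A ->
  mu A = pushforward mu shift A.
Proof.
move=> mA; apply: (lebesgue_measure_unique (mu := pushforward mu shift)) => //.
move=> _ [[a b] _ <-] /=.
rewrite /pushforward (_ : _ @^-1` _ = [set` `](a - c)%R, (b - c)%R]]).
  rewrite !lebesgue_measure_itv /= !lte_fin ltrD2r; case: ifPn => // _.
  by congr EFin; ring.
by apply/seteqP; split => x /=; rewrite !in_itv/= ltrBlDr lerBrDr.
Qed.

Lemma ge0_integral_translation (f : T -> \bar R) :
  measurable_fun setT f -> (forall x, 0 <= f x) ->
  \int[mu]_x f (x + c)%R = \int[mu]_x f x.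
Proof.
move=> mf f0; rewrite [RHS](eq_measure_integral (pushforward mu shift)); last first.
  by move=> A mA _; exact: lebesgue_measure_translation.
by rewrite ge0_integral_pushforward.
Qed.

End translation.

Let measurable_linear (a b : R) :
  measurable_fun [set: plane] (fun q => a * q.1 + b * q.2)%R.
Proof.
by apply: measurable_funD; apply: measurable_funM.
Qed.

Definition linear_map (a b c d : R) (q : plane) : plane :=
  (a * q.1 + b * q.2, c * q.1 + d * q.2)%R.

Lemma measurable_linear_map a b c d : measurable_fun setT (linear_map a b c d).
Proof. by apply/measurable_fun_pairP; split; exact: measurable_linear. Qed.

Definition preserves (phi : plane -> plane) := forall F : plane -> \bar R,
  measurable_fun setT F -> (forall q, 0 <= F q) ->
  \int[mu2]_q F (phi q) = \int[mu2]_q F q.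

Lemma preserves_shear1 t : preserves (linear_map 1 t 0 1).
Proof.
move=> F mF F0; have mFs : measurable_fun setT (F \o linear_map 1 t 0 1).
  exact: measurableT_comp (measurable_linear_map _ _ _ _).
rewrite (@fubini_tonelli2 _ _ _ _ _ mu mu _ mFs); last by move=> q; exact: F0.
rewrite (@fubini_tonelli2 _ _ _ _ _ mu mu _ mF)//.
apply: eq_integral => y _; rewrite /fubini_G /linear_map /=.
rewrite -(@ge0_integral_translation (t * y)%R (fun x => F (x, y)))//.
  by apply: eq_integral => x _; rewrite !mul1r mul0r add0r.
exact: measurableT_comp.
Qed.

Lemma preserves_shear2 t : preserves (linear_map 1 0 t 1).
Proof.
move=> F mF F0; have mFs : measurable_fun setT (F \o linear_map 1 0 t 1).
  exact: measurableT_comp (measurable_linear_map _ _ _ _).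
rewrite (@fubini_tonelli1 _ _ _ _ _ mu mu _ mFs); last by move=> q; exact: F0.
rewrite (@fubini_tonelli1 _ _ _ _ _ mu mu _ mF)//.
apply: eq_integral => x _; rewrite /fubini_F /linear_map /=.
rewrite -(@ge0_integral_translation (t * x)%R (fun y => F (x, y)))//.
  by apply: eq_integral => y _; rewrite !mul1r mul0r addr0 addrC.
exact: measurableT_comp.
Qed.

Lemma preserves_comp phi psi : measurable_fun setT phi ->
  preserves phi -> preserves psi -> preserves (phi \o psi).
Proof.
move=> mphi pphi ppsi F mF F0; rewrite -(pphi F)//.
rewrite -(ppsi (F \o phi))//.
  exact: measurableT_comp.
by move=> q; exact: F0.
Qed.

(** A rotation other than the half-turn is a product of three shears, and
    shears preserve the measure by Tonelli's theorem and translation invariance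
    on the line.  The half-turn is the square of a quarter-turn. *)
Lemma preserves_rotation (a b : R) : (a ^+ 2 + b ^+ 2 = 1)%R ->
  preserves (linear_map a (- b) b a).
Proof.
move=> ab1; have [aN1|aN1] := eqVneq a (- 1)%R; last first.
  (* minus the tangent of half the angle of the rotation *)
  pose t := (- b / (1 + a))%R.
  have a1 : (1 + a != 0)%R by rewrite addrC -(opprK 1%R) subr_eq0.
  have -> : linear_map a (- b) b a =
      linear_map 1 t 0 1 \o (linear_map 1 0 b 1 \o linear_map 1 t 0 1).
    have E : (a = 1 + t * b)%R.
      have : (b ^+ 2 = (1 - a) * (1 + a))%R by rewrite -subr_sqr expr1n -ab1 addrAC subrr add0r.
      rewrite /t expr2 mulrAC mulNr => ->.
      by rewrite mulNr mulfK// ; ring.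
    have E2 : (- b = t * (1 + a))%R by rewrite /t divfK.
    apply/funext => -[x y]; rewrite /linear_map /=; congr (_, _).
      by rewrite E2 E; ring.
    by rewrite E; ring.
  apply: preserves_comp; first exact: measurable_linear_map.
    exact: preserves_shear1.
  apply: preserves_comp; first exact: measurable_linear_map.
    exact: preserves_shear2.
  exact: preserves_shear1.
have b0 : b = 0%R.
  by apply/eqP; rewrite -sqrf_eq0; move: ab1; rewrite aN1 sqrrN expr1n; move/eqP; lra.
have quarter : preserves (linear_map 0 (- 1) 1 0).
  have := (@preserves_comp _ _ (measurable_linear_map 1 (-1) 0 1) (preserves_shear1 (-1))
    (preserves_comp (measurable_linear_map 1 0 1 1) (preserves_shear2 1) (preserves_shear1 (-1)))).
  rewrite (_ : _ \o _ = linear_map 0 (- 1) 1 0)//.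
  by apply/funext => -[x y]; rewrite /linear_map /=; congr (_, _); ring.
rewrite (_ : linear_map a (- b) b a = linear_map 0 (- 1) 1 0 \o linear_map 0 (- 1) 1 0).
  by apply: preserves_comp => //; exact: measurable_linear_map.
by apply/funext => -[x y]; rewrite /linear_map aN1 b0 /=; congr (_, _); ring.
Qed.

End plane_rotation.

(** * Sub-mean value inequality on discs *)

Section disc_submean.
Context {R : realType}.
Local Notation T := (measurableTypeR R).
Local Notation plane := (measurableTypeR R * measurableTypeR R)%type.
Local Notation mu := (@lebesgue_measure R).
Local Notation mu2 := (prod_measure mu mu).

Definition toC (q : plane) : R[i] := (q.1 +i* q.2)%C.

Definition translate (a q : plane) : plane := (q.1 + a.1, q.2 + a.2).

Lemma measurable_translate a : measurable_fun setT (translate a).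
Proof. by apply/measurable_fun_pairP; split; apply: measurable_funD. Qed.

Lemma preserves_translate a : preserves (translate a).
Proof.
move=> F mF F0; have mFt : measurable_fun setT (F \o translate a).
  exact: measurableT_comp (measurable_translate _).
rewrite !(@fubini_tonelli1 _ _ _ _ _ mu mu)//.
rewrite -[RHS](@ge0_integral_translation _ a.1); last 2 first.
- exact: measurable_fun_fubini_tonelli_F.
- by move=> x; apply: integral_ge0.
apply: eq_integral => x _; rewrite /fubini_F /translate /=.
rewrite -(@ge0_integral_translation _ a.2 (fun y => F (x + a.1, y)))//.
exact: measurableT_comp.
Qed.

Lemma toC_rotation t (q : plane) :
  toC (linear_map (cos t) (- sin t) (sin t) (cos t) q) = cis t * toC q.
Proof.
apply/eqP; rewrite eq_complex /= /toC /linear_map /= mulNr eqxx andTb.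
by rewrite addrC.
Qed.

(** By rotation invariance the integral of [|f| ^ p] over the disc is that of
    the average over [N] rotates, which nearly exceeds [|f a| ^ p] everywhere by
    [rotation_average].  The factor [rho ^+ 2] is the area of a square inside
    the disc, used in place of the area of the disc itself. *)
Lemma disc_submean (f : R[i] -> R[i]) (a : plane) (p rho : R)
    (G := fun q => if cmod (toC q - toC a) < rho
                   then (cmod (f (toC q)) `^ p)%:E else 0%E) :
  0 < p -> 0 < rho ->
  (forall z, cmod (z - toC a) <= 2 * rho -> differentiable f z) ->
  measurable_fun setT G ->
  ((rho ^+ 2 * cmod (f (toC a)) `^ p)%:E <= \int[mu2]_q G q)%E.
Proof.
move=> p0 rho0 df mG.
have G0 q : (0 <= G q)%E by rewrite /G; case: ifP => //; rewrite lee_fin powR_ge0.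
rewrite -(@preserves_translate a G)//.
pose H q := G (translate a q).
have mH : measurable_fun setT H by exact: measurableT_comp (measurable_translate _).
have H0 q : (0 <= H q)%E := G0 _.
have HE q : cmod (toC q) < rho -> H q = (cmod (f (toC a + toC q)) `^ p)%:E.
  rewrite /H /G => qrho; have -> : toC (translate a q) = toC a + toC q.
    by apply/eqP; rewrite eq_complex /= (addrC q.1) (addrC q.2) !eqxx.
  by rewrite addrAC subrr add0r qrho.
pose S : set plane := `](- (rho / 2)), (rho / 2)[ `*` `](- (rho / 2)), (rho / 2)[.
have mS : measurable S by exact: measurableX.
have muS : mu2 S = (rho ^+ 2)%:E.
  rewrite /prod_measure product_measure1E//= !lebesgue_measure_itv/= lte_fin.
  rewrite ifT; last by lra.
  by rewrite -EFinM; congr EFin; field.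
have Srho q : S q -> cmod (toC q) < rho.
  move=> [/=]; rewrite !in_itv/= -!ltr_norml => h1 h2.
  have h3 : cmod (toC q) <= `|q.1| + `|q.2| := ler_cmod_ReIm (toC q).
  by apply: le_lt_trans h3 _; lra.
pose K := cmod (f (toC a)) `^ p.
have K0 : 0 <= K := powR_ge0 _ _.
have int_cst (c : R) : 0 <= c ->
    (\int[mu2]_q (c%:E * (\1_S q)%:E) = (c * rho ^+ 2)%:E)%E.
  move=> c0; rewrite ge0_integralZl//=; last first.
    by apply/measurable_EFinP; exact: measurable_indic.
  rewrite integral_indic// setIT; transitivity (c%:E * mu2 S)%E => //.
  by rewrite muS.
suff main e : 0 < e -> ((rho ^+ 2 * K)%:E <= \int[mu2]_q H q + (e * rho ^+ 2)%:E)%E.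
  apply/lee_addgt0Pr => e e0.
  have := main (e / rho ^+ 2); rewrite divfK ?expf_neq0 ?gt_eqF//; apply.
  by rewrite divr_gt0// exprn_gt0.
move=> e0; have [N N0 NP] := rotation_average p0 rho0 e0 df.
have Nr0 : 0 < N%:R :> R by rewrite ltr0n.
pose w k := 2 * pi * k%:R / N%:R : R.
pose rot k := linear_map (cos (w k)) (- sin (w k)) (sin (w k)) (cos (w k)).
have mrot k : measurable_fun setT (rot k) by exact: measurable_linear_map.
have rotP k : (\int[mu2]_q H (rot k q) = \int[mu2]_q H q)%E.
  by apply: preserves_rotation => //; exact: cos2Dsin2.
have indic0 q : (0 <= e%:E * (\1_S q)%:E)%E by rewrite mule_ge0// lee_fin// ltW.
have mI (c : R) : measurable_fun setT (fun q : plane => c%:E * (\1_S q)%:E)%E.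
  by apply: measurable_funeM; apply/measurable_EFinP; exact: measurable_indic.
have mHr k : measurable_fun setT (fun q => H (rot k q)).
  exact: measurableT_comp.
have mterm k : measurable_fun setT (fun q => H (rot k q) + e%:E * (\1_S q)%:E)%E.
  exact: emeasurable_funD.
rewrite -(@lee_pmul2l _ N%:R%:E)//.
have -> : (N%:R%:E * (\int[mu2]_q H q + (e * rho ^+ 2)%:E) =
    \int[mu2]_q (\sum_(k < N) (H (rot k q) + e%:E * (\1_S q)%:E)))%E.
  rewrite ge0_integral_sum//; last by move=> k q _; rewrite adde_ge0 ?H0 ?indic0.
  under eq_bigr => k _.
    rewrite ge0_integralD//.
    rewrite rotP int_cst ?ltW//.
    over.
  by rewrite sumr_const card_ord mule_natl.
rewrite -EFinM (_ : N%:R * _ = N%:R * K * rho ^+ 2); last by ring.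
have NK0 : 0 <= N%:R * K by rewrite mulr_ge0// ltW.
rewrite -int_cst//; apply: ge0_le_integral => //.
- by move=> q _; rewrite mule_ge0// lee_fin.
- exact: emeasurable_sum.
move=> q _; have [Sq|nSq] := pselect (S q); last first.
  rewrite indicE memNset// mule0; apply: sume_ge0 => k _.
  by apply: adde_ge0; [exact: H0|rewrite mule0].
rewrite indicE mem_set//= mule1.
have hk (k : 'I_N) : (H (rot k q) + e%:E * 1%:E =
    (cmod (f (toC a + cis (w k) * toC q)) `^ p + e)%:E)%E.
  by rewrite mule1 HE toC_rotation// cmodM cmod_cis mul1r Srho.
under eq_bigr do rewrite hk.
by rewrite sumEFin lee_fin; apply: NP; rewrite ltW// Srho.
Qed.

End disc_submean.

(** * Measurability of continuous functions of several plane variables *)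

Section measurability.
Context {R : realType}.
Local Notation T := (measurableTypeR R).
Local Notation plane := (measurableTypeR R * measurableTypeR R)%type.

(** A function with countably many values is measurable for every family of
    sets as soon as its fibres are. *)
Lemma measurable_preimage_count d (X : measurableType d) (I : countType)
    (idx : X -> I) (B : set I) :
  (forall i, measurable (idx @^-1` [set i])) -> measurable (idx @^-1` B).
Proof.
move=> midx; pose E m := [set x | pickle (idx x) = m].
rewrite (_ : _ @^-1` _ = \bigcup_(m in [set pickle i | i in B]) E m).
  apply: bigcup_measurable => _ [i _ <-].
  rewrite (_ : E _ = idx @^-1` [set i])//.
  apply/seteqP; split => x /=; last by move=> <-.
  exact: (pcan_inj pickleK).
apply/seteqP; split => [x Bx|x [_ [i Bi <-]] /=].
  by exists (pickle (idx x)) => //; exists (idx x).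
by move=> /(pcan_inj pickleK) ->.
Qed.

Variable n : nat.
Local Notation space := (n.-tuple plane).

Let grid k (x : R) : int := Num.floor (k.+1%:R * x).
Let cell k (t : space) : {ffun 'I_n -> int * int} :=
  [ffun j => (grid k (tnth t j).1, grid k (tnth t j).2)].
Let corner k (i : {ffun 'I_n -> int * int}) : space :=
  [tuple ((i j).1%:~R / k.+1%:R, (i j).2%:~R / k.+1%:R) | j < n].

Let measurable_cell k i : measurable (cell k @^-1` [set i]).
Proof.
have mgrid z : measurable [set x : T | grid k x = z].
  rewrite (_ : [set _ | _] = `[z%:~R / k.+1%:R, (z + 1)%:~R / k.+1%:R[%classic).
    exact: measurable_itv.
  apply/seteqP; split => x /=; rewrite in_itv/= ler_pdivrMr// ltr_pdivlMr//.
    by move=> <-; rewrite [x * _]mulrC floor_itv.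
  by rewrite [x * _]mulrC => /floor_def.
rewrite (_ : _ @^-1` _ = \bigcap_(j in [set: 'I_n])
   (fun t : space => tnth t j) @^-1`
     ([set x | grid k x = (i j).1] `*` [set x | grid k x = (i j).2])).
  apply: fin_bigcap_measurable => // j _.
  rewrite -[X in measurable X]setTI; apply: measurable_tnth => //.
  exact: measurableX.
apply/seteqP; split => [t /= <- j _ /=|t H /=]; first by rewrite ffunE.
apply/ffunP => j; rewrite ffunE; have [/= -> ->] := H j Logic.I.
by case: (i j).
Qed.

Let grid_near k (x : R) : `|(grid k x)%:~R / k.+1%:R - x| <= k.+1%:R^-1.
Proof.
have /andP[h1 h2] := floor_itv (k.+1%:R * x).
have k0 : 0 < k.+1%:R :> R by [].
rewrite ler_norml lerBrDr lerBlDr ler_pdivlMr// ler_pdivrMr// !mulrDl.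
rewrite mulNr mulVf ?gt_eqF// [x * _]mulrC.
by move: h1 h2; rewrite -/(grid k x) intrD; lra.
Qed.

(** [g] is the pointwise limit on [P] of its values at the lower corners of the
    cells of the grids of mesh [1 / (k + 1)], and these step functions take
    countably many values. *)
Lemma continuous_measurable_tuple (P : set space) (g : space -> R) :
  (forall t, P t -> forall e : R, 0 < e -> exists2 d : R, 0 < d &
    forall t', (forall j, `|(tnth t' j).1 - (tnth t j).1| < d /\
                          `|(tnth t' j).2 - (tnth t j).2| < d) ->
      `|g t' - g t| <= e) ->
  measurable_fun P g.
Proof.
move=> gP; apply: (@measurable_fun_cvg _ _ _ P (fun k t => g (corner k (cell k t)))).
  move=> k; apply: measurable_funTS => _ B mB; rewrite setTI.
  rewrite (_ : _ @^-1` B = cell k @^-1` [set i | B (g (corner k i))])//.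
  exact: measurable_preimage_count.
move=> t Pt; apply/cvgrPdist_le => e e0; have [d d0 dP] := gP t Pt e e0.
near=> k; rewrite distrC; apply: dP => j; rewrite tnth_mktuple ffunE /=.
have kd : k.+1%:R^-1 < d by near: k; exact: near_infty_natSinv_lt (PosNum d0).
by split; apply: le_lt_trans (grid_near _ _) kd.
Unshelve. all: by end_near. Qed.

End measurability.

(** * Sub-mean value inequality on polydiscs *)

Section polydisc.
Context {R : realType}.
Local Notation T := (measurableTypeR R).
Local Notation plane := (measurableTypeR R * measurableTypeR R)%type.
Local Notation mu := (@lebesgue_measure R).
Local Notation mu2 := (prod_measure mu mu).
Variables (p rho : R).
Hypotheses (p0 : 0 < p) (rho0 : 0 < rho).

Definition update n (x : 'I_n -> R[i]) (j : 'I_n) (z : R[i]) : 'I_n -> R[i] :=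
  fun k => if k == j then z else x k.

Definition cons_fun n (q : R[i]) (x : 'I_n -> R[i]) : 'I_n.+1 -> R[i] :=
  fun k => if unlift ord0 k is Some j then x j else q.

(** Points are functions on ['I_n] so that [cons_fun] can peel off the first
    coordinate, as [tuple_measure] does. *)
Definition separately_holomorphic n (a : 'I_n -> plane)
    (h : ('I_n -> R[i]) -> R[i]) :=
  forall x, (forall j, cmod (x j - toC (a j)) <= 2 * rho) -> forall j,
    differentiable (fun z => h (update x j z)) (x j).

Definition polydisc_pow n (a : 'I_n -> plane) (h : ('I_n -> R[i]) -> R[i])
    (t : n.-tuple plane) : \bar R :=
  if [forall j, cmod (toC (tnth t j) - toC (a j)) < rho]
  then (cmod (h (fun j => toC (tnth t j))) `^ p)%:E else 0%E.

Lemma polydisc_pow_ge0 n (a : 'I_n -> plane) h t : (0 <= polydisc_pow a h t)%E.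
Proof. by rewrite /polydisc_pow; case: ifP => // _; rewrite lee_fin powR_ge0. Qed.

Lemma polydisc_pow_cons n (a : 'I_n.+1 -> plane) h q (t : n.-tuple plane) :
  polydisc_pow a h (cons_pair (q, t)) =
  if cmod (toC q - toC (a ord0)) < rho
  then polydisc_pow (a \o lift ord0) (fun x => h (cons_fun (toC q) x)) t
  else 0%E.
Proof.
rewrite /polydisc_pow.
have E : (fun j => toC (tnth (cons_pair (q, t)) j)) =
    cons_fun (toC q) (fun j => toC (tnth t j)).
  apply/funext => j; rewrite /cons_fun; case: unliftP => [i|] ->.
    by rewrite tnthS.
  by rewrite tnth0.
rewrite E; case: ifPn => [/forallP H|/forallPn[j nH]].
  have := H ord0; rewrite tnth0 => ->; rewrite ifT//.
  by apply/forallP => j; have := H (lift ord0 j); rewrite tnthS.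
case: ifPn => // h0; rewrite ifF//; apply/negP => /forallP H.
move: nH; case: (unliftP ord0 j) => [i|] ->; first by rewrite tnthS H.
by rewrite tnth0 h0.
Qed.

Lemma separately_holomorphic_cons n (a : 'I_n.+1 -> plane) h q :
  separately_holomorphic a h -> cmod (toC q - toC (a ord0)) <= 2 * rho ->
  separately_holomorphic (a \o lift ord0) (fun x => h (cons_fun (toC q) x)).
Proof.
move=> hh qa x xa j.
have := hh (cons_fun (toC q) x) _ (lift ord0 j).
have -> : cons_fun (toC q) x (lift ord0 j) = x j by rewrite /cons_fun liftK.
have -> : (fun z => h (update (cons_fun (toC q) x) (lift ord0 j) z)) =
          (fun z => h (cons_fun (toC q) (update x j z))).
  apply/funext => z; congr h; apply/funext => k; rewrite /update /cons_fun.
  case: unliftP => [i|] ->; first by rewrite (inj_eq lift_inj).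
  by rewrite (negbTE (neq_lift _ _)).
apply=> k; rewrite /cons_fun; by case: unliftP => [i|] ->.
Qed.

(** Induction on the number of variables: Tonelli's theorem isolates the first
    coordinate, the induction hypothesis treats the others with the first one
    frozen, and [disc_submean] treats the first with the others at the centre. *)
Lemma polydisc_submean n (a : 'I_n -> plane) h :
  separately_holomorphic a h -> measurable_fun setT (polydisc_pow a h) ->
  (((rho ^+ 2) ^+ n * cmod (h (fun j => toC (a j))) `^ p)%:E <=
    \int[lebesgue_tuple n]_t polydisc_pow a h t)%E.
Proof.
elim: n a h => [|n IH] a h hh mh.
  rewrite /lebesgue_tuple /= integral_dirac// diracT mul1e expr0 mul1r.
  rewrite /polydisc_pow ifT; last by apply/forallP => -[].
  by rewrite lee_fin le_eqVlt; apply/orP; left; apply/eqP; congr (cmod (h _) `^ p);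
    apply/funext => -[].
have mhc : measurable_fun setT (polydisc_pow a h \o @cons_pair _ plane n).
  by apply: (measurableT_comp mh); exact: measurable_cons_pair.
have -> : (\int[lebesgue_tuple n.+1]_t polydisc_pow a h t =
    \int[prod_measure mu2 (lebesgue_tuple n)]_q polydisc_pow a h (cons_pair q))%E.
  rewrite /lebesgue_tuple /= /cons_measure ge0_integral_pushforward//.
    exact: measurable_cons_pair.
  by move=> t _; exact: polydisc_pow_ge0.
rewrite (@fubini_tonelli1 _ _ _ _ _ mu2 (lebesgue_tuple n) _ mhc); last first.
  by move=> q; exact: polydisc_pow_ge0.
pose h0 z := h (cons_fun z (fun j => toC (a (lift ord0 j)))).
pose G q := if cmod (toC q - toC (a ord0)) < rho
            then (cmod (h0 (toC q)) `^ p)%:E else 0%E.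
have G0 q : (0 <= G q)%E by rewrite /G; case: ifP => // _; rewrite lee_fin powR_ge0.
have Gslice q : G q = polydisc_pow a h (cons_pair (q, [tuple a (lift ord0 j) | j < n])).
  rewrite polydisc_pow_cons /G; case: ifP => // _.
  rewrite /polydisc_pow ifT; last first.
    by apply/forallP => j; rewrite tnth_mktuple subrr cmod0.
  congr (_ `^ _)%:E; congr (cmod (h _)); congr cons_fun.
  by apply/funext => j; rewrite tnth_mktuple.
have mG : measurable_fun setT G.
  rewrite (_ : G = (polydisc_pow a h \o @cons_pair _ plane n) \o
     (fun q => (q, [tuple a (lift ord0 j) | j < n]))).
    apply: measurableT_comp => //.
  by apply/funext => q; rewrite Gslice.
pose k := (rho ^+ 2) ^+ n; have k0 : 0 <= k by rewrite !exprn_ge0// ltW.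
apply: (@le_trans _ _ (\int[mu2]_q (k%:E * G q))%E).
  rewrite ge0_integralZl//.
  rewrite exprS -mulrA mulrCA EFinM; apply: lee_wpmul2l; first by rewrite lee_fin.
  have := @disc_submean R h0 (a ord0) p rho p0 rho0.
  have -> : h0 (toC (a ord0)) = h (fun j => toC (a j)).
    congr h; apply/funext => j; rewrite /cons_fun.
    by case: unliftP => [i|] ->.
  apply => // z za.
  have := hh (cons_fun z (fun j => toC (a (lift ord0 j)))) _ ord0.
  have -> : cons_fun z (fun j => toC (a (lift ord0 j))) ord0 = z.
    by rewrite /cons_fun unlift_none.
  have -> : (fun w => h (update (cons_fun z (fun j => toC (a (lift ord0 j)))) ord0 w))
     = h0.
    apply/funext => w; congr h; apply/funext => j; rewrite /update /cons_fun.
    by case: unliftP => [i|] ->; rewrite ?eqxx// eq_sym (negbTE (neq_lift _ _)).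
  apply=> j; rewrite /cons_fun; case: unliftP => [i|] -> //.
  by rewrite subrr cmod0 mulr_ge0// ltW.
apply: ge0_le_integral => //.
- by move=> q _; rewrite mule_ge0.
- exact: measurable_funeM.
- by apply: measurable_fun_fubini_tonelli_F => // q; exact: polydisc_pow_ge0.
move=> q _; rewrite /fubini_F /=.
have [qa|qa] := boolP (cmod (toC q - toC (a ord0)) < rho); last first.
  by rewrite /G (negbTE qa) mule0 integral_ge0// => t _; exact: polydisc_pow_ge0.
rewrite /G qa -EFinM.
have E t : polydisc_pow a h (cons_pair (q, t)) =
    polydisc_pow (a \o lift ord0) (fun x => h (cons_fun (toC q) x)) t.
  by rewrite polydisc_pow_cons qa.
rewrite [leRHS](_ : _ = \int[lebesgue_tuple n]_t
    polydisc_pow (a \o lift ord0) (fun x => h (cons_fun (toC q) x)) t)%E; last first.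
  by apply: eq_integral => t _; exact: E.
apply: (IH (a \o lift ord0) (fun x => h (cons_fun (toC q) x))).
  by apply: separately_holomorphic_cons => //; have := cmod_ge0 (toC q - toC (a ord0)); lra.
rewrite (_ : polydisc_pow _ _ = (polydisc_pow a h \o @cons_pair _ plane n) \o (pair q)).
  exact: measurableT_comp.
by apply/funext => t; rewrite -E.
Qed.

End polydisc.

(** * Pointwise bounds from weighted integrals *)

Section point_estimate.
Context {R : realType}.
Local Notation plane := (measurableTypeR R * measurableTypeR R)%type.

(** The integral of a nonnegative function is a supremum over the simple
    functions below it, so monotonicity holds without measurability.  This
    avoids proving that the integrand built from [phi] is measurable. *)
Lemma ge0_integral_mono d (X : measurableType d) (mu : {measure set X -> \bar R})
    (D1 D2 : set X) (f1 f2 : X -> \bar R) :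
  (forall x, D1 x -> 0 <= f1 x)%E -> (forall x, D2 x -> 0 <= f2 x)%E ->
  (forall x, D1 x -> D2 x -> f1 x <= f2 x)%E ->
  (forall x, D1 x -> ~ D2 x -> f1 x = 0%E) ->
  (\int[mu]_(x in D1) f1 x <= \int[mu]_(x in D2) f2 x)%E.
Proof.
move=> f10 f20 f12 f1D; rewrite integral_mkcond [leRHS]integral_mkcond.
rewrite !ge0_integralTE//; try by move=> x; apply: erestrict_ge0.
apply: le_ereal_sup => _ /= [h hf <-]; exists h => // x.
apply: le_trans (hf x) _; rewrite !patchE.
case: ifPn => [/set_mem x1|_]; case: ifPn => [/set_mem x2|x2] //.
- exact: f12.
- by rewrite f1D// => /mem_set; apply/negP.
- exact: f20.
Qed.

Lemma nbhs_rV_cmod n (z : 'rV[R[i]]_n) (A : set 'rV[R[i]]_n) : nbhs z A ->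
  exists2 d : R, 0 < d & forall w : 'rV[R[i]]_n, (forall j, cmod (w 0 j - z 0 j) < d) -> A w.
Proof.
move=> /nbhs_ballP[d /= d0 dA].
have [dr dE] : exists dr, d = (dr%:C)%C by apply/complex_realP/gtr0_real.
have dr0 : 0 < dr by rewrite -ltcR -dE.
exists dr => // w wz; apply: dA; split => // i j.
by rewrite ord1 /ball /= normC_cmod dE ltcR -opprB cmodN.
Qed.

Lemma differentiable_cmod_continuous n (f : 'rV[R[i]]_n -> R[i]) z :
  differentiable f z -> forall e : R, 0 < e -> exists2 d : R, 0 < d &
    forall w : 'rV[R[i]]_n, (forall j, cmod (w 0 j - z 0 j) < d) -> cmod (f w - f z) < e.
Proof.
move=> /differentiable_continuous /cvgrPdist_lt fz e e0.
have := fz (e%:C)%C; rewrite ltcR => /(_ e0) /nbhs_rV_cmod[d d0 dP].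
exists d => // w wz; have := dP w wz.
by rewrite normC_cmod ltcR -opprB cmodN.
Qed.

Lemma row_cmod_bound n (b : 'rV[R[i]]_n) :
  exists2 B : R, 0 < B & forall j, cmod (b 0 j) <= B.
Proof.
have sum0 : 0 <= \sum_j cmod (b 0 j) by apply: sumr_ge0 => j _; exact: cmod_ge0.
exists (1 + \sum_j cmod (b 0 j)) => [|j]; first by rewrite ltr_pwDl.
rewrite (bigD1 j)//= addrCA lerDl addr_ge0//.
by apply: sumr_ge0 => i _; exact: cmod_ge0.
Qed.

Lemma cmod_toCB (q q' : plane) (d : R) : `|q'.1 - q.1| < d / 2 ->
  `|q'.2 - q.2| < d / 2 -> cmod (toC q' - toC q) < d.
Proof.
move=> h1 h2.
have h : cmod (toC q' - toC q) <= `|q'.1 - q.1| + `|q'.2 - q.2| := ler_cmod_ReIm _.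
by apply: le_lt_trans h _; lra.
Qed.

Definition ofC (z : R[i]) : plane := (complex.Re z, complex.Im z).

Lemma ofCK z : toC (ofC z) = z.
Proof. by case: z. Qed.

(** The weight [exp (- m * phi)] is at least [exp (- m * g)] on the polydisc, so
    [polydisc_submean] applies to [|f| ^ p] after factoring this constant out. *)
Lemma point_estimate n (D : set 'rV[R[i]]_n) (phi : 'rV[R[i]]_n -> \bar R)
    (f : 'rV[R[i]]_n -> R[i]) (z : 'rV[R[i]]_n) (p rho g m : R) :
  0 < p -> 0 < rho -> 0 <= m ->
  (forall w : 'rV[R[i]]_n, (forall j, cmod (w 0 j - z 0 j) <= 2 * rho) -> D w) ->
  holomorphic D f ->
  (forall w : 'rV[R[i]]_n, (forall j, cmod (w 0 j - z 0 j) < rho) -> (phi w <= g%:E)%E) ->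
  (((rho ^+ 2) ^+ n * cmod (f z) `^ p * expR (- (m * g)))%:E <=
   integral_Cn D (fun w => (cmod (f w) `^ p)%:E * expeR (- (m%:E * phi w))))%E.
Proof.
move=> p0 rho0 m0 zD holf phig.
pose a j : plane := ofC (z 0 j).
pose h (x : 'I_n -> R[i]) := f (\row_j x j).
have hz : h (fun j => toC (a j)) = f z.
  by rewrite /h; congr f; apply/rowP => j; rewrite mxE ofCK.
have hsep : separately_holomorphic rho a h.
  move=> x xa j.
  apply: (@differentiable_comp _ _ _ _ (fun w => \row_k update x j w k) f).
    rewrite (_ : (fun w => _) = (fun w : R[i] =>
        (\row_k (if k == j then 0 else x k)) + w *: (delta_mx 0 j : 'rV[R[i]]_n))).
      by apply: differentiableD => //; exact: differentiableZl.
    apply/funext => w; apply/rowP => k; rewrite !mxE /update eqxx.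
    by case: eqVneq => _; rewrite ?mulr1 ?mulr0 ?addr0 ?add0r.
  apply: holf; apply: zD => k; rewrite mxE /update; have := xa k.
  by rewrite ofCK; case: eqVneq => [->|].
pose P := [set t : n.-tuple plane | forall j, cmod (toC (tnth t j) - z 0 j) < rho].
have mP : measurable P.
  rewrite (_ : P = \bigcap_(j in [set: 'I_n])
     ((fun t : n.-tuple plane => cmod (toC (tnth t j) - z 0 j)) @^-1` `]-oo, rho[)).
    apply: fin_bigcap_measurable => // j _; rewrite -[X in measurable X]setTI.
    apply: continuous_measurable_tuple => // t _ e e0.
    exists (e / 2); first by rewrite divr_gt0.
    move=> t' /(_ j)[h1 h2]; apply: le_trans (le_cmodB _ _) _.
    have -> : toC (tnth t' j) - z 0 j - (toC (tnth t j) - z 0 j) =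
      toC (tnth t' j) - toC (tnth t j) by ring.
    by rewrite ltW// cmod_toCB.
  by apply/seteqP; split => [t Pt j _|t Pt j]; have := Pt j; rewrite /= in_itv//=; apply.
have Gpatch : polydisc_pow p rho a h =
    (fun t => (cmod (f (complexify t)) `^ p)%:E) \_ P.
  apply/funext => t; rewrite patchE /polydisc_pow /P.
  have -> : (t \in P) = [forall j, cmod (toC (tnth t j) - toC (a j)) < rho].
    apply/idP/forallP => [/set_mem Pt j|Pt]; first by rewrite ofCK.
    by apply/mem_set => j; have := Pt j; rewrite ofCK.
  by case: ifP.
have PD t : P t -> D (complexify t).
  move=> Pt; apply: zD => j; rewrite mxE; have := Pt j.
  by rewrite /toC; lra.
have mG : measurable_fun setT (polydisc_pow p rho a h).
  rewrite Gpatch; apply/(measurable_restrictT _ _).1 => //.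
  apply/measurable_EFinP; apply: continuous_measurable_tuple => t Pt e e0.
  have [d1 d10 H1] := powR_continuous_ge0 p0 (cmod_ge0 (f (complexify t))) e0.
  have [d d0 dP] := differentiable_cmod_continuous (holf _ (PD _ Pt)) d10.
  exists (d / 2); first by rewrite divr_gt0.
  move=> t' tt'; apply: H1; first exact: cmod_ge0.
  apply: le_lt_trans (le_cmodB _ _) _; apply: dP => j; rewrite !mxE.
  by have [] := tt' j; exact: cmod_toCB.
have := polydisc_submean p0 rho0 hsep mG; rewrite hz => sub.
rewrite EFinM muleC.
apply: (@le_trans _ _ (\int[lebesgue_tuple n]_t
   ((expR (- (m * g)))%:E * polydisc_pow p rho a h t))%E).
  rewrite ge0_integralZl//; last by move=> t _; exact: polydisc_pow_ge0.
  by apply: lee_wpmul2l => //; rewrite lee_fin expR_ge0.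
apply: ge0_integral_mono.
- by move=> t _; rewrite mule_ge0 ?lee_fin ?expR_ge0 ?polydisc_pow_ge0.
- by move=> t _; rewrite mule_ge0 ?expeR_ge0// lee_fin powR_ge0.
- move=> t _ Dt; rewrite Gpatch patchE; case: ifPn => [/set_mem Pt|_]; last first.
    by rewrite mule0 mule_ge0 ?expeR_ge0// lee_fin powR_ge0.
  rewrite muleC; apply: lee_wpmul2l; first by rewrite lee_fin powR_ge0.
  rewrite -[leLHS]/(expeR (- (m%:E * g%:E))) lee_expeR leeN2.
  apply: lee_wpmul2l => //; apply: phig => j; rewrite mxE; exact: Pt.
- move=> t _ nDt; rewrite Gpatch patchE ifF ?mule0//.
  by apply/negP => /set_mem/PD.
Qed.

End point_estimate.

(** * From averages over arcs to integral means *)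

Section limit_of_arc_averages.
Context {R : realType}.
Local Notation mu := (@lebesgue_measure R).

Lemma ereal_real_between (x y : \bar R) : (x < y)%E ->
  exists r : R, (x < r%:E < y)%E.
Proof.
move: x y => [x| |] [y| |] //.
- by rewrite lte_fin => xy; exists ((x + y) / 2); rewrite !lte_fin; lra.
- by move=> _; exists (x + 1); rewrite lte_fin ltry; lra.
- by move=> _; exists (y - 1); rewrite lte_fin ltNyr; lra.
- by move=> _; exists 0; rewrite ltNyr ltry.
Qed.

(** Fatou's lemma for functions [H N] that eventually exceed any number below
    [V].  The limit inferior is compared with [V] by [ge0_integral_mono]. *)
Lemma fatou_le d (X : measurableType d) (nu : {measure set X -> \bar R})
    (A : set X) (V : X -> \bar R) (H : (X -> \bar R)^nat) (B : \bar R) :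
  measurable A -> (forall N, measurable_fun A (H N)) ->
  (forall x, A x -> 0 <= V x)%E ->
  (forall N x, A x -> 0 <= H N x)%E ->
  (forall N, \int[nu]_(x in A) H N x <= B)%E ->
  (forall x, A x -> forall a : R, (a%:E < V x)%E ->
     exists N0, forall N, (N0 <= N)%N -> (a%:E <= H N x)%E) ->
  (\int[nu]_(x in A) V x <= B)%E.
Proof.
move=> mA mH V0 H0 HB HV.
have einfE (w : (\bar R)^nat) : limn_einf w = ereal_sup (range (einfs w)).
  by rewrite limn_einf_lim; apply/cvg_lim => //; exact: cvg_einfs_sup.
apply: (@le_trans _ _ (\int[nu]_(x in A) limn_einf (H^~ x))%E).
  apply: ge0_integral_mono => // [x Ax|x Ax _].
    rewrite einfE; apply: (@le_trans _ _ (einfs (H^~ x) 0)).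
      by apply: le_ereal_inf_tmp => _ [N /= _ <-]; exact: H0.
    by apply: ereal_sup_ubound; exists 0.
  rewrite leNgt; apply/negP => lt.
  have [a /andP[a1 a2]] : exists a : R, (limn_einf (H^~ x) < a%:E < V x)%E.
    exact: ereal_real_between.
  have [N0 N0P] := HV x Ax a a2.
  move: a1; apply/negP; rewrite -leNgt einfE.
  apply: (@le_trans _ _ (einfs (H^~ x) N0)); last by apply: ereal_sup_ubound; exists N0.
  by apply: le_ereal_inf_tmp => _ [N /= N0N <-]; exact: N0P.
apply: le_trans (fatou _ mA mH H0) _; rewrite einfE.
apply: ge_ereal_sup => _ [N _ <-]; apply: le_trans (HB N).
by apply: ereal_inf_lbound; exists N => /=.
Qed.

Definition angle_arc (N j : nat) : set R :=
  `[2 * pi * j%:R / N.+1%:R, 2 * pi * j.+1%:R / N.+1%:R].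

Lemma arc_endS N j : 2 * pi * j.+1%:R / N.+1%:R =
  2 * pi * j%:R / N.+1%:R + 2 * pi / N.+1%:R :> R.
Proof.
have -> : j.+1%:R = j%:R + 1 :> R by rewrite natr1.
by rewrite mulrDr mulr1 mulrDl.
Qed.

Lemma arc_measure N j : mu (angle_arc N j) = (2 * pi / N.+1%:R)%:E.
Proof.
rewrite lebesgue_measure_itv/= lte_fin arc_endS.
have pi20 : 0 < 2 * pi :> R by rewrite mulr_gt0// pi_gt0.
by rewrite ltrDl divr_gt0// -EFinB addrAC subrr add0r.
Qed.

Lemma arc_cover N t : 0 <= t <= 2 * pi -> exists j : 'I_N.+1, angle_arc N j t.
Proof.
move=> /andP[t0 t2].
have pi20 : 0 < 2 * pi :> R by rewrite mulr_gt0// pi_gt0.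
have N0 : 0 < N.+1%:R :> R by [].
pose x := t * N.+1%:R / (2 * pi).
have tE : t = 2 * pi * x / N.+1%:R.
  by rewrite [2 * pi * x]mulrC /x divfK ?gt_eqF// mulfK ?gt_eqF.
have x0 : 0 <= x by apply: divr_ge0; [exact: mulr_ge0|exact: ltW].
have inarc (j : nat) : j%:R <= x <= j.+1%:R -> angle_arc N j t.
  move=> /andP[h1 h2]; rewrite /angle_arc /= in_itv/= tE.
  by rewrite !ler_pM2r ?invr_gt0// !ler_pM2l// h1.
have /andP[h1 h2] := truncn_itv x0.
have [jN|Nj] := ltnP (Num.truncn x) N.+1.
  by exists (Ordinal jN); apply: inarc; rewrite /= h1 ltW.
exists ord_max; apply: inarc => /=.
apply/andP; split; first by rewrite (le_trans _ h1)// ler_nat ltnW.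
by rewrite /x ler_pdivrMr// mulrC ler_pM2l.
Qed.

(** Fatou's lemma is applied to the nonnegative function [M - u] and to step
    functions equal to [M - g N j] on the [j]-th arc.  The arcs are closed, so
    at their ends two steps add up; this only increases the step function there
    and does not change its integral. *)
Lemma mean_ge_of_arc_averages (u : R -> \bar R) (c M : R) (g : nat -> nat -> R) :
  (forall t (a : R), (u t < a%:E)%E -> \forall s \near t, (u s < a%:E)%E) ->
  (forall t, 0 <= t <= 2 * pi -> (u t <= M%:E)%E) ->
  (forall N j, (j < N.+1)%N -> g N j <= M) ->
  (forall N, N.+1%:R * c <= \sum_(j < N.+1) g N j) ->
  (forall t, 0 <= t <= 2 * pi -> forall a : R, (u t < a%:E)%E ->
    exists N0, forall N, (N0 <= N)%N -> forall j, (j < N.+1)%N ->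
      angle_arc N j t -> g N j <= a) ->
  (c%:E <= (2 * pi)^-1%:E * \int[mu]_(t in `[0%R, (2 * pi)%R]) u t)%E.
Proof.
move=> usc uM gM cg gu.
have pi20 : 0 < 2 * pi :> R by rewrite mulr_gt0// pi_gt0.
pose A : set R := `[0, 2 * pi]%classic.
have AE t : A t -> 0 <= t <= 2 * pi by rewrite /A /= in_itv.
have muA : mu A = (2 * pi)%:E.
  by rewrite /A lebesgue_measure_itv/= lte_fin pi20 sube0.
have mA : measurable A by exact: measurable_itv.
pose V t := (M%:E - u t)%E.
have V0 t : A t -> (0 <= V t)%E.
  move=> /AE/uM; rewrite /V; case: (u t) => [r| |].
  - by rewrite -EFinB !lee_fin subr_ge0.
  - by rewrite leye_eq.
  - by rewrite addey// leey.
have VE (s a : R) : (a%:E < V s)%E = (u s < (M - a)%:E)%E.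
  rewrite /V; case: (u s) => [r| |].
  - by rewrite -EFinB !lte_fin ltrBrDr ltrBrDl.
  - by rewrite addeNy !ltNge leNye leey.
  - by rewrite addey// ltry ltNyr.
have mV : measurable_fun A V.
  apply: measurable_funTS; apply: lower_semicontinuous_measurable => t a aV.
  move: aV; rewrite VE => /usc near_u; exists [set s | (u s < (M - a)%:E)%E] => // s /=.
  by rewrite VE.
pose H N t := (\sum_(j < N.+1) (M - g N j)%:E * (\1_(angle_arc N j) t)%:E)%E.
have Mg N (j : 'I_N.+1) : (0 <= (M - g N j)%:E)%E by rewrite lee_fin subr_ge0 gM.
have marc N j : measurable (angle_arc N j) by exact: measurable_itv.
have mI N (j : 'I_N.+1) : measurable_fun A (fun t => (M - g N j)%:E * (\1_(angle_arc N j) t)%:E)%E.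
  by apply: measurable_funeM; apply/measurable_EFinP/measurable_indic; exact: marc.
have I0 N (j : 'I_N.+1) t : (0 <= (M - g N j)%:E * (\1_(angle_arc N j) t)%:E)%E.
  by rewrite mule_ge0// lee_fin.
have HB N : (\int[mu]_(t in A) H N t <= (2 * pi * (M - c))%:E)%E.
  rewrite /H ge0_integral_sum//; last by move=> j; exact: mI.
  apply: (@le_trans _ _ (\sum_(j < N.+1) ((M - g N j) * (2 * pi / N.+1%:R))%:E)%E).
    apply: lee_sum => j _; rewrite ge0_integralZl//; last first.
      by apply/measurable_EFinP/measurable_indic; exact: marc.
    rewrite integral_indic; [|exact: mA|exact: marc].
    rewrite EFinM; apply: lee_wpmul2l => //.
    rewrite -(arc_measure N j); apply: le_measure; rewrite ?inE//.
    - by apply: measurableI => //; exact: marc.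
    - exact: marc.
  rewrite sumEFin lee_fin -mulr_suml sumrB sumr_const card_ord.
  have := cg N; set s := \sum_(j < N.+1) _ => cgN.
  have N0 : 0 < N.+1%:R :> R by [].
  rewrite mulrA ler_pdivrMr// [leLHS]mulrC -[leRHS]mulrA ler_pM2l//.
  by rewrite -mulr_natr; lra.
have intV : (\int[mu]_(t in A) V t <= (2 * pi * (M - c))%:E)%E.
  apply: (@fatou_le _ (measurableTypeR R) mu A V H) => //.
  - by move=> N; apply: emeasurable_sum => j; exact: mI.
  - by move=> N t _; apply: sume_ge0.
  move=> t At a aV; have ut : (u t < (M - a)%:E)%E by rewrite -VE.
  have [N0 N0P] := gu t (AE _ At) _ ut; exists N0 => N N0N.
  have [j jt] := arc_cover N (AE _ At).
  rewrite /H (bigD1 j)//= indicE mem_set// mule1.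
  apply: (@le_trans _ _ ((M - g N j)%:E + 0)%E).
    by rewrite adde0 lee_fin lerBrDr -lerBrDl N0P.
  by apply: leeD => //; apply: sume_ge0.
have iV : mu.-integrable A V.
  apply/integrableP; split => //.
  under eq_integral => t /[!inE] tA do rewrite gee0_abs ?V0//.
  by rewrite (le_lt_trans intV)// ltry.
have iM : mu.-integrable A (cst M%:E).
  apply/integrableP; split; first exact: measurable_cst.
  rewrite (_ : (fun x => _) = cst `|M%:E|%E)// integral_cst//= muA.
  by rewrite -EFinM ltry.
have -> : (\int[mu]_(t in A) u t = \int[mu]_(t in A) (cst M%:E \- V) t)%E.
  apply: eq_integral => t /[!inE] /AE/uM utM; rewrite /V /=.
  by case: (u t) utM => [r| |]//= _; rewrite -?EFinB//; congr EFin; ring.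
rewrite integralB// integral_cst//= muA.
have Vfin : (\int[mu]_(t in A) V t)%E \is a fin_num by exact: integrable_fin_num.
rewrite -(fineK Vfin) in intV *; rewrite -EFinM lee_fin.
rewrite lee_fin in intV.
rewrite mulrC ler_pdivlMr//; lra.
Qed.

End limit_of_arc_averages.

(** * Sub-mean value inequality on circles, and plurisubharmonicity *)

Section circles_in_domain.
Context {R : realType} (n : nat).
Variables (D : set 'rV[R[i]]_n) (phi : 'rV[R[i]]_n -> \bar R).
Hypothesis openD : open D.
Hypothesis phi_ltoo : forall z, D z -> (phi z < +oo)%E.
Hypothesis phi_usc : usc_on D phi.

(** Upper semicontinuity within an open set, on polydiscs with a real radius. *)
Lemma usc_polydisc (z : 'rV[R[i]]_n) (A : R) : D z -> (phi z < A%:E)%E ->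
  exists2 d : R, 0 < d & forall w : 'rV[R[i]]_n,
    (forall j, cmod (w 0 j - z 0 j) < d) -> D w /\ (phi w < A%:E)%E.
Proof.
move=> Dz zA; have [d1 d10 H1] := nbhs_rV_cmod (open_nbhs_nbhs (conj openD Dz)).
have := phi_usc Dz zA; rewrite near_withinE => /nbhs_rV_cmod[d2 d20 H2].
exists (Num.min d1 d2); first by rewrite lt_min d10.
move=> w wz; have Dw : D w by apply: H1 => j; have := wz j; rewrite lt_min => /andP[].
by split => //; apply: H2 => // j; have := wz j; rewrite lt_min => /andP[].
Qed.

Variables (a b : 'rV[R[i]]_n) (c : R[i]) (r : R).
Hypothesis r0 : 0 < r.
Hypothesis discD : forall s, cmod (s - c) <= r -> D (a + s *: b).

Let curve t := a + circle_point c r t *: b.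

Lemma circle_pointE t : circle_point c r t = c + r%:C%C * cis t.
Proof. by []. Qed.

Let curveD t : D (curve t).
Proof.
apply: discD; rewrite circle_pointE addrAC subrr add0r cmodM cmodR cmod_cis.
by rewrite mulr1 ger0_norm// ltW.
Qed.

Lemma curve_lipschitz : exists L d : R, [/\ 0 < L, 0 < d &
  forall t t', `|t' - t| < d -> forall j,
    cmod (curve t' 0 j - curve t 0 j) <= L * `|t' - t|].
Proof.
have [d d0 H] := cis_near1 (R := R).
have [B B0 bB] := row_cmod_bound b.
exists (2 * r * B), d; split; rewrite ?mulr_gt0// => t t' tt' j.
rewrite !mxE !circle_pointE.
have -> : a 0 j + (c + r%:C%C * cis t') * b 0 j - (a 0 j + (c + r%:C%C * cis t) * b 0 j)
    = r%:C%C * (cis t * (cis (t' - t) - 1)) * b 0 j.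
  by rewrite mulrBr -cisD mulr1 (addrC t) subrK; ring.
rewrite !cmodM cmodR cmod_cis mul1r ger0_norm ?(ltW r0)//.
have -> : 2 * r * B * `|t' - t| = (r * (2 * `|t' - t|)) * B by ring.
apply: ler_pM; rewrite ?mulr_ge0 ?cmod_ge0 ?(ltW r0)//.
by rewrite ler_pM2l// H.
Qed.


(** Compactness of the circle makes the bound and the radius uniform. *)
Lemma circle_nbhd_bound : exists M rho : R, [/\ 0 < M, 0 < rho &
  forall t, 0 <= t <= 2 * pi -> forall w : 'rV[R[i]]_n,
    (forall j, cmod (w 0 j - curve t 0 j) <= rho) -> D w /\ (phi w <= M%:E)%E].
Proof.
have [L [d [L0 d0 lip]]] := curve_lipschitz.
pose P (k : nat) (t : R) := forall w : 'rV[R[i]]_n,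
  (forall j, cmod (w 0 j - curve t 0 j) <= k.+1%:R^-1) ->
  D w /\ (phi w <= k.+1%:R%:E)%E.
have cK : compact (`[0, 2 * pi] : set R) by exact: segment_compact.
have : \forall k \near \oo, `[0, 2 * pi]%classic `<=` P k.
  apply: (compact_near_coveringP _).1 => // t _.
  have [A tA] : exists A : R, (phi (curve t) < A%:E)%E.
    have := phi_ltoo (curveD t); case: (phi (curve t)) => [x| |]// _.
      by exists (x + 1); rewrite lte_fin; lra.
    by exists 0; exact: ltNyr.
  have [d1 d10 H1] := usc_polydisc (curveD t) tA.
  pose d2 := Num.min d (d1 / (2 * L)).
  have d20 : 0 < d2 by rewrite lt_min d0 divr_gt0// mulr_gt0.
  exists (ball t d2, [set k : nat | k.+1%:R^-1 < d1 / 2 /\ A <= k.+1%:R]).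
    split => /=; first exact: nbhsx_ballx.
    have d120 : 0 < d1 / 2 by rewrite divr_gt0.
    near=> k; split.
      by near: k; exact: near_infty_natSinv_lt (PosNum d120).
    near: k; exists (Num.truncn A) => // k /= Ak.
    by rewrite (le_trans (ltW (truncnS_gt A)))// ler_nat.
  move=> [t' k] [/= tt' [kd kA]] w wt'.
  have tt'2 : `|t' - t| < d2 by rewrite distrC.
  have [//|Dw wA] := H1 w.
    move=> j; have h1 := wt' j.
    have h2 : cmod (curve t' 0 j - curve t 0 j) <= L * `|t' - t|.
      by apply: lip; rewrite (lt_le_trans tt'2)// ge_min lexx.
    have h3 : `|t' - t| < d1 / (2 * L).
      by rewrite (lt_le_trans tt'2)// ge_min lexx orbT.
    have -> : w 0 j - curve t 0 j =
      (w 0 j - curve t' 0 j) + (curve t' 0 j - curve t 0 j) by ring.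
    apply: le_lt_trans (ler_cmodD _ _) _.
    have h4 : L * `|t' - t| < d1 / 2.
      have -> : d1 / 2 = L * (d1 / (2 * L)) by field; rewrite gt_eqF.
      by rewrite ltr_pM2l.
    by rewrite [ltRHS]splitr ltrD// ?(le_lt_trans h1)// (le_lt_trans h2).
  by split => //; rewrite ltW// (lt_le_trans wA)// lee_fin.
move=> [k _ kP]; exists k.+1%:R, k.+1%:R^-1; split => // t tI w wt.
by apply: (kP k (leqnn k) t) => //=; rewrite in_itv.
Unshelve. all: by end_near. Qed.

Variables (p : R) (C : nat -> R).
Hypothesis p0 : 0 < p.
Hypothesis C0 : forall m, (0 < m)%N -> 0 < C m.
Hypothesis Clim : (fun m : nat => m%:R^-1 * ln (C m)) @ \oo --> (0 : R).
Variable v : R.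
Hypothesis ext : forall m : nat, (0 < m)%N -> exists f : 'rV[R[i]]_n -> R[i],
  [/\ holomorphic D f, f (a + c *: b) = 1 &
      (integral_Cn D (fun z => (cmod (f z) `^ p)%:E * expeR (- (m%:R%:E * phi z)))
        <= (C m)%:E * expeR (- (m%:R%:E * v%:E)))%E].

Lemma arc_sub_circle N j (t : R) : (j < N.+1)%N -> angle_arc N j t -> 0 <= t <= 2 * pi.
Proof.
move=> jN; rewrite /angle_arc /= in_itv/= => /andP[h1 h2].
have pi20 : 0 < 2 * pi :> R by rewrite mulr_gt0// pi_gt0.
apply/andP; split; first by rewrite (le_trans _ h1)// !mulr_ge0// ltW// pi_gt0.
rewrite (le_trans h2)// ler_pdivrMr// ler_pM2l// ler_nat//.
Qed.

(** The polydiscs have a fixed radius [rho], so the constant [kap] of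
    [point_estimate] is the same for all [m] and disappears, like [C m], after
    division by [m]. *)
Lemma arc_average_ge N (rho : R) (g : nat -> R) : 0 < rho ->
  (forall t, 0 <= t <= 2 * pi -> forall w : 'rV[R[i]]_n,
    (forall j, cmod (w 0 j - curve t 0 j) <= 2 * rho) -> D w) ->
  (forall k t, (k < N.+1)%N -> angle_arc N k t -> forall w : 'rV[R[i]]_n,
    (forall j, cmod (w 0 j - curve t 0 j) < rho) -> (phi w <= (g k)%:E)%E) ->
  N.+1%:R * v <= \sum_(k < N.+1) g k.
Proof.
move=> rho0 rhoD phig.
pose kap := (rho ^+ 2) ^+ n; have kap0 : 0 < kap by rewrite !exprn_gt0.
have step m : (0 < m)%N -> 0 <= N.+1%:R * (ln (C m) - ln kap) +
    m%:R * (\sum_(k < N.+1) g k - N.+1%:R * v).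
  move=> m0; have [f [holf fz fint]] := ext m0.
  pose F s := f (a + (c + r%:C%C * s) *: b).
  have dF s : cmod s <= 1 -> differentiable F s.
    move=> s1; apply: (@differentiable_comp _ _ _ _ (fun s => a + (c + r%:C%C * s) *: b) f).
      apply: differentiableD => //; apply: differentiableZl.
      by apply: differentiableD => //; apply: differentiableM.
    apply: holf; apply: discD; rewrite addrAC subrr add0r cmodM cmodR.
    by rewrite ger0_norm ?(ltW r0)// ler_piMr// ltW.
  have [t tI tP] := @max_modulus_prod R F N.+1 isT dF.
  have F0 : F 0 = 1 by rewrite /F mulr0 addr0.
  rewrite F0 cmod1 expr1n in tP.
  pose q k := ln (C m) - ln kap + m%:R * (g k - v).
  have qP k : (k < N.+1)%N ->
      cmod (F (cis (t + 2 * pi * k%:R / N.+1%:R))) `^ p <= expR (q k).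
    move=> kN; set s := t + _.
    have sk : angle_arc N k s.
      move: tI => /andP[t0 tN]; rewrite /angle_arc /= in_itv/= /s (arc_endS N k).
      by rewrite lerDr t0/= addrC lerD2l.
    have sI := arc_sub_circle kN sk.
    have := point_estimate p0 rho0 (ler0n R m) (rhoD s sI) holf (phig k s kN sk).
    move=> /le_trans /(_ fint).
    rewrite -/(F (cis s)) -/kap -[leRHS]/((C m * expR (- (m%:R * v)))%:E) lee_fin => H.
    have -> : expR (q k) = C m * expR (- (m%:R * v)) / (kap * expR (- (m%:R * g k))).
      rewrite /q !expRD expRN !lnK ?posrE ?C0// mulrBr expRD !expRN.
      by field; rewrite !gt_eqF ?expR_gt0.
    rewrite ler_pdivlMr ?mulr_gt0 ?expR_gt0//.
    by rewrite mulrCA mulrA.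
  have : 1 <= \prod_(k < N.+1) expR (q k).
    have : 1 `^ p <= (\prod_(k < N.+1) cmod (F (cis (t + 2 * pi * k%:R / N.+1%:R)))) `^ p.
      apply: ge0_ler_powR tP; rewrite ?nnegrE ?(ltW p0)//.
      by apply: prodr_ge0 => k _; exact: cmod_ge0.
    rewrite powR1 powR_prod; last by move=> k; exact: cmod_ge0.
    move=> /le_trans; apply; apply: ler_prod => k _.
    by rewrite powR_ge0/= qP.
  rewrite -expR_sum leNgt expR_lt1 -leNgt /q big_split/= sumr_const card_ord.
  by rewrite -mulr_sumr sumrB sumr_const card_ord !mulr_natl.
rewrite leNgt; apply/negP => lt.
pose delta := N.+1%:R * v - \sum_(k < N.+1) g k.
have delta0 : 0 < delta by rewrite subr_gt0.
have N0 : 0 < N.+1%:R :> R by [].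
have e0 : 0 < delta / (4 * N.+1%:R) by rewrite divr_gt0// mulr_gt0.
have /cvgrPdist_lt /(_ _ e0) [M0 _ M0P] := Clim.
(* large enough for N ln (C m) / m and N |ln kap| / m to be below delta / 4 *)
pose m := (maxn M0 (Num.truncn (4 * `|N.+1%:R * ln kap| / delta))).+1.
have m0 : 0 < m%:R :> R by [].
have M0m : (M0 <= m)%N by rewrite leqW// leq_maxl.
have := M0P m M0m; rewrite /= sub0r normrN => lnC.
have kapm : `|N.+1%:R * ln kap| < m%:R * (delta / 4).
  have : 4 * `|N.+1%:R * ln kap| / delta < m%:R.
    apply: lt_le_trans (truncnS_gt _) _.
    by rewrite ler_nat ltnS leq_maxr.
  by rewrite ltr_pdivrMr//; lra.
have lnC' : N.+1%:R * ln (C m) < m%:R * (delta / 4).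
  move: lnC; rewrite normrM ger0_norm ?invr_ge0 ?(ltW m0)// => lnC.
  have : `|ln (C m)| < m%:R * (delta / (4 * N.+1%:R)) by rewrite mulrC -ltr_pdivrMr// mulrC.
  move=> /(le_lt_trans (ler_norm _)) h.
  have -> : m%:R * (delta / 4) = N.+1%:R * (m%:R * (delta / (4 * N.+1%:R))).
    by field; rewrite gt_eqF.
  by rewrite ltr_pM2l.
have := step m isT.
have -> : \sum_(k < N.+1) g k - N.+1%:R * v = - delta by rewrite opprB.
move: kapm; rewrite ltr_norml => /andP[h1 h2].
have md : 0 < m%:R * delta by rewrite mulr_gt0.
by lra.
Qed.


Lemma usc_on_circle t (A : R) : (phi (curve t) < A%:E)%E ->
  exists2 d : R, 0 < d & forall s, `|s - t| < d -> forall w : 'rV[R[i]]_n,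
    (forall j, cmod (w 0 j - curve s 0 j) < d) -> (phi w < A%:E)%E.
Proof.
move=> tA; have [L [d1 [L0 d10 lip]]] := curve_lipschitz.
have [d2 d20 H2] := usc_polydisc (curveD t) tA.
exists (Num.min d1 (Num.min (d2 / (2 * L)) (d2 / 2))).
  by rewrite !lt_min d10 !divr_gt0// mulr_gt0.
move=> s; rewrite !lt_min => /and3P[st1 st2 st3] w ws.
have [//|//] := H2 w; move=> j.
have -> : w 0 j - curve t 0 j =
  (w 0 j - curve s 0 j) + (curve s 0 j - curve t 0 j) by ring.
apply: le_lt_trans (ler_cmodD _ _) _; rewrite [ltRHS]splitr ltrD//.
  by have := ws j; rewrite !lt_min => /and3P[].
apply: le_lt_trans (lip _ _ st1 j) _.
have -> : d2 / 2 = L * (d2 / (2 * L)) by field; rewrite gt_eqF.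
by rewrite ltr_pM2l.
Qed.

(** The bound [G N j] is the supremum of [phi] over a neighbourhood of the [j]-th
    arc whose radius [eps N] tends to [0].  This supremum is [-oo] when [phi] is [-oo]
    there, hence the maximum with [- (N + 1)], which is real and tends to [-oo]. *)
Lemma le_circle_mean : (v%:E <= circle_mean (fun s => phi (a + s *: b)) c r)%E.
Proof.
have [M [rho [M0 rho0 HM]]] := circle_nbhd_bound.
pose eps N := rho / 2 / N.+1%:R.
have eps0 N : 0 < eps N by rewrite !divr_gt0.
have eps_rho N : 2 * eps N <= rho.
  have -> : 2 * eps N = rho / N.+1%:R by rewrite /eps; field.
  by rewrite ler_pdivrMr// ler_peMr ?ler1n// ltW.
pose near_arc N j := [set w : 'rV[R[i]]_n | exists2 t, angle_arc N j t &
  forall i, cmod (w 0 i - curve t 0 i) < eps N].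
pose G N j := maxe (- N.+1%:R)%:E (ereal_sup (phi @` near_arc N j)).
have near_arcM N j w : (j < N.+1)%N -> near_arc N j w -> (phi w <= M%:E)%E.
  move=> jN [t tj wt]; apply: (proj2 (HM t _ w _)).
    exact: arc_sub_circle tj.
  by move=> i; have := wt i; have := eps_rho N; have := eps0 N; lra.
have GM N j : (j < N.+1)%N -> (G N j <= M%:E)%E.
  move=> jN; rewrite /G ge_max; apply/andP; split.
    by rewrite lee_fin (le_trans _ (ltW M0))// lerNl oppr0.
  by apply: ge_ereal_sup => _ [w wj <-]; exact: near_arcM wj.
have Gfin N j : (j < N.+1)%N -> (fine (G N j))%:E = G N j.
  move=> jN; rewrite fineK// fin_numE; apply/andP; split.
    by rewrite gt_eqF// (@lt_le_trans _ _ (- N.+1%:R)%:E) ?ltNyr// le_max lexx.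
  by rewrite lt_eqF// (le_lt_trans (GM _ _ jN))// ltry.
have phiG N j w : (j < N.+1)%N -> near_arc N j w -> (phi w <= (fine (G N j))%:E)%E.
  move=> jN wj; rewrite Gfin// /G le_max; apply/orP; right.
  by apply: ereal_sup_ubound; exists w.
apply: (@mean_ge_of_arc_averages R (fun t => phi (curve t)) v M
   (fun N j => fine (G N j))).
- move=> t A /usc_on_circle[d d0 H].
  apply/nbhs_ballP; exists d => // s; rewrite /ball/= distrC => st.
  by apply: (H s st (curve s)) => j; rewrite subrr cmod0.
- move=> t tI; apply: (proj2 (HM t tI (curve t) _)) => j.
  by rewrite subrr cmod0 ltW.
- by move=> N j jN; rewrite -lee_fin Gfin// GM.
- move=> N; apply: (@arc_average_ge N (eps N) (fun j => fine (G N j))) => //.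
    move=> t tI w wt; apply: (proj1 (HM t tI w _)) => j.
    exact: le_trans (wt j) (eps_rho N).
  by move=> k t kN tk w wt; apply: phiG => //; exists t.
move=> t tI A /usc_on_circle[d d0 H].
have pi20 : 0 < 2 * pi :> R by rewrite mulr_gt0// pi_gt0.
pose e := Num.min (d / (2 * pi)) (d / rho).
have e0 : 0 < e by rewrite lt_min !divr_gt0.
have [N0 _ N0P] : \forall N \near \oo, N.+1%:R^-1 < e /\ - A <= N.+1%:R.
  near=> N; split; first by near: N; exact: near_infty_natSinv_lt (PosNum e0).
  near: N; exists (Num.truncn (- A)) => // N /= AN.
  by rewrite (le_trans (ltW (truncnS_gt _)))// ler_nat.
exists N0 => N N0N j jN tj; have [Ne NA] := N0P N N0N.
have [Ne1 Ne2] : N.+1%:R^-1 < d / (2 * pi) /\ N.+1%:R^-1 < d / rho.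
  by move: Ne; rewrite lt_min => /andP[].
rewrite -lee_fin Gfin// /G ge_max; apply/andP; split; first by rewrite lee_fin lerNl.
apply: ge_ereal_sup => _ [w [s sj ws] <-]; apply: ltW; apply: (H s) => [|i].
  apply: (@le_lt_trans _ _ (2 * pi / N.+1%:R)); last first.
    by rewrite mulrC -ltr_pdivlMr.
  move: tj sj; rewrite /angle_arc /= !in_itv/= (arc_endS N j).
  move: (2 * pi * j%:R / N.+1%:R) (2 * pi / N.+1%:R) => x y /andP[? ?] /andP[? ?].
  by rewrite ler_norml; lra.
apply: lt_le_trans (ws i) _; rewrite /eps mulrAC.
have : rho * N.+1%:R^-1 < d by rewrite mulrC -ltr_pdivlMr.
have : 0 < rho * N.+1%:R^-1 by rewrite divr_gt0.
by move: (rho * _) => x; lra.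
Unshelve. all: by end_near. Qed.

End circles_in_domain.


Theorem theorem1p1 (R : realType) (n : nat) (hn : (0 < n)%N)
  (D : set 'rV[R[i]]_n) (hD : domain D)
  (phi : 'rV[R[i]]_n -> \bar R)
  (phi_ltoo : forall z, D z -> (phi z < +oo)%E)
  (phi_usc : usc_on D phi)
  (phi_nontrivial : exists2 z, D z & phi z <> -oo%E)
  (p : R) (hp : 0 < p)
  (C : nat -> R) (hC : forall m, (0 < m)%N -> 0 < C m)
  (hlim : (fun m : nat => m%:R^-1 * ln (C m)) @ \oo --> (0 : R))
  (hext : forall z0, D z0 -> (-oo < phi z0)%E ->
     forall m : nat, (0 < m)%N ->
     exists f : 'rV[R[i]]_n -> R[i],
       [/\ holomorphic D f,
           f z0 = 1 &
           (integral_Cn D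
              (fun z => (cmod (f z) `^ p)%:E * expeR (- (m%:R%:E * phi z)))
            <= (C m)%:E * expeR (- (m%:R%:E * phi z0)))%E]) :
  plurisubharmonic D phi.
Proof.
have [_ oD _] := hD.
split=> // a b; split=> [s /phi_ltoo//|s Ds A sA|c r r0 discD].
  have [d d0 H] := usc_polydisc oD phi_usc Ds sA.
  have [B B0 bB] := row_cmod_bound b.
  rewrite near_withinE; apply/nbhs_ballP; exists (d / B)%:C%C => /=.
    by rewrite ltcR divr_gt0.
  move=> s'; rewrite /ball/= normC_cmod ltcR => ss' _.
  apply: (proj2 (H _ _)) => j; rewrite !mxE.
  have -> : a 0 j + s' * b 0 j - (a 0 j + s * b 0 j) = (s' - s) * b 0 j by ring.
  rewrite cmodM -opprB cmodN; apply: (@le_lt_trans _ _ (cmod (s - s') * B)).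
    by rewrite ler_wpM2l ?cmod_ge0.
  by rewrite -ltr_pdivlMr.
have discD' s : cmod (s - c) <= r -> D (a + s *: b) by exact: discD.
have Dc : D (a + c *: b) by apply: discD'; rewrite subrr cmod0 ltW.
have [->|cNy] := eqVneq (phi (a + c *: b)) -oo%E; first exact: leNye.
have cfin : (fine (phi (a + c *: b)))%:E = phi (a + c *: b).
  by rewrite fineK// fin_numE cNy lt_eqF// phi_ltoo.
rewrite -cfin; apply: (@le_circle_mean R n D phi oD phi_ltoo phi_usc a b c r r0
  discD' p C hp hC hlim).
move=> m m0; rewrite cfin; apply: hext => //.
by rewrite ltNye.
Qed.
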